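(* Let $L_0=A^{-1}$, $L_n=B^{-1}(n)$, $L_n'=H^{-1}(\,;n)$ and $I_n=A^{-4}(n)$ for $n\ge 1$, viewed as elements of $HH^\bullet(A)$. Then, under the Gerstenhaber bracket of $HH^\bullet(A)$: (i) $\{L_n\}_{n\ge 0}$ is the non-negative part of a Witt algebra; (ii) $\{L_n'\}_{n\ge 1}$ is the positive part of a Witt algebra; (iii) $\{L_n,I_n\}_{n\ge 1}$ is the positive part of the semidirect product $W(0,0)$ of the Witt algebra and a tensor density module.
   Context: $\mathbf{k}$ is a field of characteristic $0$, $A=\mathbf{k}\langle x,y,z\rangle/(x^2+yx,\,xz,\,zy)$, $A^e=A\otimes A^{\mathrm{op}}$, $HH^{-n}(A)=\mathrm{Ext}^n_{A^e}(A,A)$ (cohomology in non-positive degrees). The Witt algebra has bracket $[L_n,L_m]=(m-n)L_{m+n}$. The positive part of $W(0,0)$, the semidirect product of the Witt algebra with a tensor density module, has basis $\{L_n,I_n\}_{n\ge1}$ and Lie bracket given by $[L_n,L_m]=(m-n)L_{m+n}$, $[L_n,I_m]=m\,I_{m+n}$. $A$ is Koszul, and $HH^{-n}(A)$ is the $n$-th cohomology of the complex $\mathrm{Hom}(V_\bullet,A)$ coming from the two-sided Koszul resolution, where $V_0=\mathbf{k}$, $V_1=\mathbf{k}\{x,y,z\}$, $V_2=\mathbf{k}\{(x+y)x,xz,zy\}$, $V_3=\mathbf{k}\{(x+y)xz,xzy\}$, $V_4=\mathbf{k}\{(x+y)xzy\}$ (subspaces of $V_1^{\otimes n}$) and $V_n=0$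 for $n\ge 5$. The identification with the cohomology of the reduced Hochschild cochain complex $\mathrm{Hom}(\overline A^{\otimes n},A)$, $\overline A=A/\mathbf k1$, is by restricting cochains along $V_n\subset V_1^{\otimes n}\to\overline A^{\otimes n}$. The classes used are those of the Koszul cocycles: $A^{-1}$: $x\mapsto x,\ y\mapsto y,\ z\mapsto 0$; $B^{-1}(n)$: $x\mapsto y^nx,\ y\mapsto y^{n+1},\ z\mapsto 0$; $H^{-1}(\,;n)$: $x\mapsto 0,\ y\mapsto 0,\ z\mapsto z^n$ (all in $\mathrm{Hom}(V_1,A)$); $A^{-4}(n)$: $(x+y)xzy\mapsto y^nx$ (in $\mathrm{Hom}(V_4,A)$). The Gerstenhaber bracket of Hochschild cochains $f\in\mathrm{Hom}(\overline A^{\otimes n},A)$, $g\in\mathrm{Hom}(\overline A^{\otimes m},A)$ is $[f,g]=f\overline\circ g-(-1)^{(n-1)(m-1)}g\overline\circ f$, where $f\overline\circ g=\sum_{i=1}^n(-1)^{(m-1)(i-1)}f\overline\circ_i g$ and $f\overline\circ_i g$ inserts the output of $g$ in the $i$-th argument of $f$.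
   Formalization: In (ii), since [L'_n,L'_m]=(m-n)L'_{n+m-1} (e.g. [L'_1,L'_2]=L'_2), {L'_n}_{n≥1} is not the positive part of a Witt algebra; the formal theorem says it is the non-negative part, L'_{n+1} having Witt index n. *)

(* Defs.v *)
From HB Require Import structures.
From mathcomp Require Import all_boot all_algebra.
From mathcomp Require Import boolp classical_sets functions.
From mathcomp.multinomials Require Import monalg.

Set Implicit Arguments.
Unset Strict Implicit.
Unset Printing Implicit Defensive.

Import GRing.Theory.
Import Quotient.Exports.

Local Open Scope ring_scope.
Local Open Scope quotient_scope.

Section TwoSidedIdeal.
Variables (k : fieldType) (F : algType k) (rels : seq F).

(* A triple t stands for the element t.1.1 * t.1.2 * t.2, with t.1.2 a relator. *)
Definition two_sided_ideal : {pred F} := fun p =>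
  `[< exists2 s : seq (F * F * F),
        {in s, forall t, t.1.2 \in rels} &
        p = \sum_(t <- s) t.1.1 * t.1.2 * t.2 >].

Lemma two_sided_idealMl a p : p \in two_sided_ideal -> a * p \in two_sided_ideal.
Proof.
move=> /asboolP[s sR ->]; apply/asboolP.
exists [seq ((a * t.1.1, t.1.2), t.2) | t <- s].
  by move=> _ /mapP[t ts ->] /=; apply: sR.
by rewrite big_map mulr_sumr; apply: eq_bigr => t _ /=; rewrite !mulrA.
Qed.

Lemma two_sided_idealMr a p : p \in two_sided_ideal -> p * a \in two_sided_ideal.
Proof.
move=> /asboolP[s sR ->]; apply/asboolP.
exists [seq ((t.1.1, t.1.2), t.2 * a) | t <- s].
  by move=> _ /mapP[t ts ->] /=; apply: sR.
by rewrite big_map mulr_suml; apply: eq_bigr => t _ /=; rewrite !mulrA.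
Qed.

Fact two_sided_ideal_closed : zmod_closed two_sided_ideal.
Proof.
split=> [|p q pI].
  by apply/asboolP; exists [::] => //; rewrite big_nil.
move=> /(two_sided_idealMl (-1)); rewrite mulN1r => /asboolP[s2 s2R ->].
move/asboolP: pI => [s1 s1R ->]; apply/asboolP; exists (s1 ++ s2).
  by move=> t; rewrite mem_cat => /orP[/s1R|/s2R].
by rewrite big_cat.
Qed.
HB.instance Definition _ :=
  GRing.isZmodClosed.Build F two_sided_ideal two_sided_ideal_closed.

Definition alg_quot : Type := {ideal_quot two_sided_ideal}.
HB.instance Definition _ := GRing.Zmodule.on alg_quot.

Definition alg_pi (p : F) : alg_quot := \pi_({ideal_quot two_sided_ideal}) p.

Definition alg_repr (a : alg_quot) : F :=
  repr (a : {ideal_quot two_sided_ideal}).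

Lemma alg_reprK a : alg_pi (alg_repr a) = a. Proof. exact: reprK. Qed.

Lemma alg_pi_eq (p q : F) : (alg_pi p = alg_pi q) <-> (p - q \in two_sided_ideal).
Proof.
split=> [/eqP|pq]; first by rewrite -Quotient.idealrBE.
by apply/eqP; rewrite -Quotient.idealrBE.
Qed.

Lemma alg_pi0 : alg_pi 0 = 0.
Proof. exact: (raddf0 \pi_({ideal_quot two_sided_ideal})). Qed.

Lemma alg_piD p q : alg_pi (p + q) = alg_pi p + alg_pi q.
Proof. exact: (raddfD \pi_({ideal_quot two_sided_ideal})). Qed.

Lemma alg_quot_ind (P : alg_quot -> Prop) : (forall p, P (alg_pi p)) -> forall a, P a.
Proof. by move=> PP a; rewrite -(alg_reprK a). Qed.

Definition alg_mul (a b : alg_quot) : alg_quot := alg_pi (alg_repr a * alg_repr b).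
Definition alg_scale (c : k) (a : alg_quot) : alg_quot := alg_pi (c *: alg_repr a).

Lemma alg_piM p q : alg_mul (alg_pi p) (alg_pi q) = alg_pi (p * q).
Proof.
apply/alg_pi_eq; set p' := alg_repr _; set q' := alg_repr _.
have -> : p' * q' - p * q = (p' - p) * q' + p * (q' - q).
  by rewrite mulrBl mulrBr addrA subrK.
apply: rpredD; first by apply/two_sided_idealMr/alg_pi_eq; rewrite alg_reprK.
by apply/two_sided_idealMl/alg_pi_eq; rewrite alg_reprK.
Qed.

Lemma alg_piZ c p : alg_scale c (alg_pi p) = alg_pi (c *: p).
Proof.
apply/alg_pi_eq; rewrite -scalerBr -[_ - _]mul1r scalerAl.
by apply/two_sided_idealMl/alg_pi_eq; rewrite alg_reprK.
Qed.

Fact alg_mulA : associative alg_mul.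
Proof.
by elim/alg_quot_ind=> p; elim/alg_quot_ind=> q; elim/alg_quot_ind=> r;
   rewrite !alg_piM mulrA.
Qed.
Fact alg_mul1 : left_id (alg_pi 1) alg_mul.
Proof. by elim/alg_quot_ind=> p; rewrite alg_piM mul1r. Qed.
Fact alg_1mul : right_id (alg_pi 1) alg_mul.
Proof. by elim/alg_quot_ind=> p; rewrite alg_piM mulr1. Qed.
Fact alg_mulDl : left_distributive alg_mul +%R.
Proof.
elim/alg_quot_ind=> p; elim/alg_quot_ind=> q; elim/alg_quot_ind=> r.
by rewrite -alg_piD !alg_piM mulrDl alg_piD.
Qed.
Fact alg_mulDr : right_distributive alg_mul +%R.
Proof.
elim/alg_quot_ind=> p; elim/alg_quot_ind=> q; elim/alg_quot_ind=> r.
by rewrite -alg_piD !alg_piM mulrDr alg_piD.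
Qed.
HB.instance Definition _ := GRing.Zmodule_isPzRing.Build alg_quot
  alg_mulA alg_mul1 alg_1mul alg_mulDl alg_mulDr.

Fact alg_scaleA a b (v : alg_quot) :
  alg_scale a (alg_scale b v) = alg_scale (a * b) v.
Proof. by elim/alg_quot_ind: v => p; rewrite !alg_piZ scalerA. Qed.
Fact alg_scale1 : left_id 1 alg_scale.
Proof. by elim/alg_quot_ind=> p; rewrite alg_piZ scale1r. Qed.
Fact alg_scaleDr : right_distributive alg_scale +%R.
Proof.
move=> c; elim/alg_quot_ind=> p; elim/alg_quot_ind=> q.
by rewrite -alg_piD !alg_piZ scalerDr alg_piD.
Qed.
Fact alg_scaleDl (v : alg_quot) : {morph alg_scale^~ v : a b / a + b}.
Proof. by elim/alg_quot_ind: v => p a b; rewrite !alg_piZ scalerDl alg_piD. Qed.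
HB.instance Definition _ := GRing.Zmodule_isLmodule.Build k alg_quot
  alg_scaleA alg_scale1 alg_scaleDr alg_scaleDl.

Lemma alg_scaleAl (c : k) (u v : alg_quot) : c *: (u * v) = (c *: u) * v.
Proof.
elim/alg_quot_ind: u => p; elim/alg_quot_ind: v => q.
by rewrite /GRing.scale /GRing.mul /= alg_piZ !alg_piM alg_piZ scalerAl.
Qed.

Lemma alg_scaleAr (c : k) (u v : alg_quot) : c *: (u * v) = u * (c *: v).
Proof.
elim/alg_quot_ind: u => p; elim/alg_quot_ind: v => q.
by rewrite /GRing.scale /GRing.mul /= alg_piZ !alg_piM alg_piZ scalerAr.
Qed.

Lemma alg_1neq0 : 1 \notin two_sided_ideal -> (1 : alg_quot) != 0.
Proof.
move=> /negP I1; apply/eqP; rewrite -[1]/(alg_pi 1) -alg_pi0.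
by move=> /alg_pi_eq; rewrite subr0.
Qed.

End TwoSidedIdeal.

Section AlgebraA.
Variable k : fieldType.

Definition free_alg : Type := {malg k[{fmonom 'I_3}]}.
HB.instance Definition _ := GRing.Lalgebra.on free_alg.

Fact free_scaleAr (c : k) (p q : free_alg) : c *: (p * q) = p * (c *: q).
Proof.
rewrite -(mul_malgC c (q : {malg k[{fmonom 'I_3}]})) mulrA scalerAl; congr (_ * q).
rewrite [RHS]fgmulgU [LHS]malgZ_def.
by apply: eq_bigr => w _; rewrite mulm1 mulrC.
Qed.
HB.instance Definition _ := GRing.Lalgebra_isAlgebra.Build k free_alg free_scaleAr.

Definition gen (i : 'I_3) : free_alg := mkmalgU (fmu i) 1.
Local Notation fx := (gen (inord 0)).
Local Notation fy := (gen (inord 1)).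
Local Notation fz := (gen (inord 2)).

Definition relators : seq free_alg := [:: fx ^+ 2 + fy * fx; fx * fz; fz * fy].

Definition coef1 (p : free_alg) : k := @mcoeff {fmonom 'I_3} k mone p.

Fact coef1M : {morph coef1 : p q / p * q}.
Proof. exact: (@mcoeff1g_is_multiplicative {fmonom 'I_3} k).1. Qed.

Fact coef1D : {morph coef1 : p q / p + q}.
Proof. exact: mcoeffD. Qed.

Fact coef1_gen i : coef1 (gen i) = 0.
Proof.
rewrite /coef1 /gen mcoeffU1 (_ : _ == _ = false) //.
by apply/negP=> /eqP/(congr1 (@fdeg _)); rewrite fdegU fdeg1.
Qed.

Fact relators_nontrivial : 1 \notin two_sided_ideal relators.
Proof.
have c0 p q : coef1 p = 0 -> coef1 (p * q) = 0 by rewrite coef1M => ->; apply: mul0r.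
have coef1r r : r \in relators -> coef1 r = 0.
  rewrite in_cons => /orP[/eqP->|].
    by rewrite coef1D; apply: etrans (congr1 (+%R^~ _) (c0 _ _ (coef1_gen _))) _;
      rewrite add0r; apply: c0; apply: coef1_gen.
  by rewrite in_cons => /orP[|/predU1P[|//]] => [/eqP|] ->; apply: c0; apply: coef1_gen.
apply/negP=> /asboolP[s sR /(congr1 coef1)/eqP].
rewrite [coef1 1]mcoeff1 eqxx (big_morph coef1 coef1D (mcoeff0 _)).
rewrite big_seq big1 ?oner_eq0 // => t /sR/coef1r tR.
by rewrite !coef1M tR mulr0 mul0r.
Qed.

Definition algA : Type := alg_quot relators.
HB.instance Definition _ := GRing.PzRing.on algA.
HB.instance Definition _ := GRing.Lmodule.on algA.
HB.instance Definition _ :=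
  GRing.PzSemiRing_isNonZero.Build algA (alg_1neq0 relators_nontrivial).
HB.instance Definition _ :=
  GRing.Lmodule_isLalgebra.Build k algA (@alg_scaleAl k _ relators).
HB.instance Definition _ :=
  GRing.Lalgebra_isAlgebra.Build k algA (@alg_scaleAr k _ relators).

Definition Ax : algA := alg_pi relators fx.
Definition Ay : algA := alg_pi relators fy.
Definition Az : algA := alg_pi relators fz.

End AlgebraA.

Section Hochschild.
Variables (k : fieldType) (A : algType k).
Implicit Types (n m i : nat) (f g h : seq A -> A) (s t : seq A).

(* Hom (Abar^{(x) n}, A): a cochain of degree n is a function on the sequences of
   length n, extended by 0 to the sequences of any other length. *)
Definition is_cochain n f : Prop :=
  [/\ forall s, size s != n -> f s = 0,
      forall s t (c : k) a b,
        f (s ++ (c *: a + b) :: t) = c *: f (s ++ a :: t) + f (s ++ b :: t)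
    & forall s t, f (s ++ 1 :: t) = 0].

Definition hdiff n f : seq A -> A := fun s =>
  if size s == n.+1 then
    s`_0 * f (behead s)
    + \sum_(i < n) (-1) ^+ i.+1 * f (take i s ++ s`_i * s`_i.+1 :: drop i.+2 s)
    + (-1) ^+ n.+1 * (f (take n s) * s`_n)
  else 0.

Definition hcocycle n : {pred seq A -> A} := fun f =>
  `[< is_cochain n f /\ hdiff n f = 0 >].

Definition hcoboundary n : {pred seq A -> A} := fun f =>
  if n is m.+1 then `[< exists2 h, is_cochain m h & f = hdiff m h >] else f == 0.

Lemma cochain_lin n (c : k) f g :
  is_cochain n f -> is_cochain n g -> is_cochain n (c *: f + g).
Proof.
move=> [f0 fl f1] [g0 gl g1].
have E s : (c *: f + g) s = c *: f s + g s by [].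
split=> [s sn|s t b u v|s t]; rewrite !E.
- by rewrite f0 ?g0 // scaler0 addr0.
- by rewrite fl gl !scalerDr !scalerA [c * b]mulrC addrACA.
- by rewrite f1 g1 scaler0 addr0.
Qed.

Lemma cochain0 n : is_cochain n 0.
Proof.
have E s : (0 : seq A -> A) s = 0 by [].
by split=> *; rewrite !E ?scaler0 ?addr0.
Qed.

Lemma hdiff_lin n (c : k) f g : hdiff n (c *: f + g) = c *: hdiff n f + hdiff n g.
Proof.
apply/funext=> s.
have E f' g' u : (c *: f' + g') u = c *: f' u + g' u by [].
rewrite !E /hdiff; case: eqP => _; last by rewrite scaler0 addr0.
rewrite !scalerDr [RHS]addrACA (addrACA (c *: (s`_0 * _))); congr (_ + _ + _).
- by rewrite E mulrDr scalerAr.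
- rewrite scaler_sumr -big_split /=; apply: eq_bigr => i _.
  by rewrite E mulrDr scalerAr.
- by rewrite E mulrDl mulrDr scalerAr scalerAl.
Qed.

Lemma hdiff0 n : hdiff n 0 = 0.
Proof.
apply/funext=> s; have E u : (0 : seq A -> A) u = 0 by [].
rewrite /hdiff !E mul0r !mulr0 addr0 add0r; case: eqP => // _.
by rewrite big1 // => i _; rewrite E mulr0.
Qed.

Fact hcocycle_closed n : submod_closed (hcocycle n).
Proof.
split=> [|c f g /asboolP[fc fd] /asboolP[gc gd]]; apply/asboolP; split.
- exact: cochain0.
- exact: hdiff0.
- exact: cochain_lin.
- by rewrite hdiff_lin fd gd scaler0 addr0.
Qed.
HB.instance Definition _ n :=
  GRing.isSubmodClosed.Build k (seq A -> A) (hcocycle n) (hcocycle_closed n).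

Record hcocycle_of n := HCocycle { hcoc_val : seq A -> A; _ : hcoc_val \in hcocycle n }.
HB.instance Definition _ n := [isSub for @hcoc_val n].
HB.instance Definition _ n := [Choice of hcocycle_of n by <:].
HB.instance Definition _ n := [SubChoice_isSubLmodule of hcocycle_of n by <:].

Definition hcoboundary_in n : {pred hcocycle_of n} := fun u => val u \in hcoboundary n.

Fact hcoboundary_closed n : submod_closed (@hcoboundary_in n).
Proof.
split=> [|c u v]; rewrite !unfold_in /= ?raddf0 ?raddfD /= ?linearZ /=.
  case: n => [|n]; first exact: eqxx.
  by apply/asboolP; exists 0; [exact: cochain0 | rewrite hdiff0].
case: n u v => [|n] u v; first by move=> /eqP -> /eqP ->; rewrite scaler0 addr0.
move=> /asboolP[f fc ->] /asboolP[g gc ->]; apply/asboolP.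
by exists (c *: f + g); [exact: cochain_lin | rewrite hdiff_lin].
Qed.
HB.instance Definition _ n :=
  GRing.isSubmodClosed.Build k (hcocycle_of n) (@hcoboundary_in n)
    (hcoboundary_closed n).

Definition HH n : Type := {ideal_quot (@hcoboundary_in n)}.
HB.instance Definition _ n := GRing.Zmodule.on (HH n).

Definition hh_pi n (u : hcocycle_of n) : HH n :=
  \pi_({ideal_quot (@hcoboundary_in n)}) u.

Definition hh_repr n (a : HH n) : hcocycle_of n :=
  repr (a : {ideal_quot (@hcoboundary_in n)}).

Lemma hh_reprK n (a : HH n) : hh_pi (hh_repr a) = a. Proof. exact: reprK. Qed.

Lemma hh_pi_eq n (f g : hcocycle_of n) :
  (hh_pi f = hh_pi g) <-> (f - g \in @hcoboundary_in n).
Proof.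
split=> [/eqP|fg]; first by rewrite -Quotient.idealrBE.
by apply/eqP; rewrite -Quotient.idealrBE.
Qed.

Lemma hh_piD n (f g : hcocycle_of n) : hh_pi (f + g) = hh_pi f + hh_pi g.
Proof. exact: (raddfD \pi_({ideal_quot (@hcoboundary_in n)})). Qed.

Lemma hh_ind n (P : HH n -> Prop) : (forall u, P (hh_pi u)) -> forall a, P a.
Proof. by move=> PP a; rewrite -(hh_reprK a). Qed.

Definition hh_scale n (c : k) (a : HH n) : HH n := hh_pi (c *: hh_repr a).

Lemma hh_piZ n (c : k) (f : hcocycle_of n) : hh_scale c (hh_pi f) = hh_pi (c *: f).
Proof.
apply/hh_pi_eq; rewrite -scalerBr rpredZ //.
by apply/hh_pi_eq; rewrite hh_reprK.
Qed.

Fact hh_scaleA n a b (v : HH n) : hh_scale a (hh_scale b v) = hh_scale (a * b) v.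
Proof. by elim/hh_ind: v => f; rewrite !hh_piZ scalerA. Qed.
Fact hh_scale1 n : left_id 1 (@hh_scale n).
Proof. by elim/hh_ind=> f; rewrite hh_piZ scale1r. Qed.
Fact hh_scaleDr n : right_distributive (@hh_scale n) +%R.
Proof.
move=> c; elim/hh_ind=> f; elim/hh_ind=> g.
by rewrite -hh_piD !hh_piZ scalerDr hh_piD.
Qed.
Fact hh_scaleDl n (v : HH n) : {morph (@hh_scale n)^~ v : a b / a + b}.
Proof. by elim/hh_ind: v => f a b; rewrite !hh_piZ scalerDl hh_piD. Qed.
HB.instance Definition _ n := GRing.Zmodule_isLmodule.Build k (HH n)
  (@hh_scaleA n) (@hh_scale1 n) (@hh_scaleDr n) (@hh_scaleDl n).

(* The class of f when f is a cocycle; the junk value 0 otherwise. *)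
Definition hh_class n f : HH n := hh_pi (insubd (0 : hcocycle_of n) f).

(* i is counted from 0, so ginsert m i is the insertion in the (i+1)-st argument. *)
Definition ginsert m i f g : seq A -> A := fun s =>
  f (take i s ++ g (take m (drop i s)) :: drop (i + m) s).

(* (-1)^(m+1) stands for (-1)^(m-1), so that degree 0 is handled correctly. *)
Definition gcirc n m f g : seq A -> A :=
  \sum_(i < n) (-1) ^+ (m.+1 * i) *: ginsert m i f g.

Definition gbracket n m f g : seq A -> A :=
  gcirc n m f g - (-1) ^+ (n.+1 * m.+1) *: gcirc m n g f.

(* The bracket of two cocycles is a cocycle whose class depends only on their
   classes, so neither the choice of representatives nor the junk value matters. *)
Definition hh_bracket n m (a : HH n) (b : HH m) : HH (n + m).-1 :=
  hh_class (n + m).-1 (gbracket n m (val (hh_repr a)) (val (hh_repr b))).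

End Hochschild.

Section KoszulClasses.
Variable k : fieldType.
Local Notation A := (algA k).
Local Notation x := (Ax k).
Local Notation y := (Ay k).
Local Notation z := (Az k).

(* A basis of V_n, made of pure tensors v_1 (x) ... (x) v_n of elements of V_1,
   each written as the sequence of its factors.  A Koszul cochain, i.e. an element
   of Hom (V_n, A), is given by the sequence of its values on this basis. *)
Definition koszul_basis (n : nat) : seq (seq A) :=
  match n with
  | 0 => [:: [::]]
  | 1 => [:: [:: x]; [:: y]; [:: z]]
  | 2 => [:: [:: x + y; x]; [:: x; z]; [:: z; y]]
  | 3 => [:: [:: x + y; x; z]; [:: x; z; y]]
  | 4 => [:: [:: x + y; x; z; y]]
  | _ => [::]
  end.

(* The Koszul differential Hom (V_n.-1, A) -> Hom (V_n, A), evaluated at a basis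
   tensor v of V_n; it vanishes for n = 0. *)
Definition koszul_diff (psi : seq A -> A) (v : seq A) : A :=
  v`_0 * psi (behead v)
  + (-1) ^+ size v * (psi (take (size v).-1 v) * last 0 v).

(* The restriction to V_n of a cocycle in the class c is cohomologous to the Koszul
   cochain phi.  Every linear map V_n.-1 -> A is the restriction of a reduced
   cochain psi, because V_n.-1 embeds in the tensor power of A / k1. *)
Definition koszul_represents n (phi : seq A) (c : HH A n) : Prop :=
  exists2 psi : seq A -> A, is_cochain n.-1 psi &
    [seq val (hh_repr c) v - koszul_diff psi v | v <- koszul_basis n] = phi.

(* The inverse of the restriction isomorphism: A is Koszul, so a Koszul cocycle phi
   is represented by exactly one class. *)
Definition koszul_class n (phi : seq A) : HH A n :=
  xget 0 [set c | koszul_represents phi c].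

Definition clsA1 : HH A 1 := koszul_class 1 [:: x; y; 0].
Definition clsB1 (n : nat) : HH A 1 := koszul_class 1 [:: y ^+ n * x; y ^+ n.+1; 0].
Definition clsH1 (n : nat) : HH A 1 := koszul_class 1 [:: 0; 0; z ^+ n].
Definition clsA4 (n : nat) : HH A 4 := koszul_class 4 [:: y ^+ n * x].

End KoszulClasses.

Section WittAlgebras.
Variables (k : fieldType) (A : algType k).

Definition free_from (V : lmodType k) (s : nat) (e : nat -> V) : Prop :=
  forall (N : nat) (c : nat -> k),
    \sum_(s <= n < N) c n *: e n = 0 -> forall n, (s <= n < N)%N -> c n = 0.

(* {L_n}_{n >= s} is a basis of its span, with the Witt bracket. *)
Definition witt_part (s : nat) (L : nat -> HH A 1) : Prop :=
  free_from s L /\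
  forall n m, (s <= n)%N -> (s <= m)%N ->
    hh_bracket (L n) (L m) = (m%:R - n%:R) *: L (m + n)%N.

(* The families L and I lie in distinct degrees, so that L together with I is
   linearly independent as soon as each of them is. *)
Definition W00_positive_part (L : nat -> HH A 1) (I : nat -> HH A 4) : Prop :=
  [/\ witt_part 1 L,
      free_from 1 I,
      forall n m, (1 <= n)%N -> (1 <= m)%N ->
        hh_bracket (L n) (I m) = m%:R *: I (m + n)%N,
      forall n m, (1 <= n)%N -> (1 <= m)%N ->
        hh_bracket (I m) (L n) = - (m%:R *: I (m + n)%N)
    & forall n m, (1 <= n)%N -> (1 <= m)%N -> hh_bracket (I n) (I m) = 0].

End WittAlgebras.

(* Main.v *)
Require Import Defs.
From HB Require Import structures.
From mathcomp Require Import all_boot all_algebra ssrAC.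
From mathcomp Require Import boolp classical_sets functions.
From mathcomp.finmap Require Import finmap.
From mathcomp.multinomials Require Import monalg.

(* Write u = x + y.  The right multiplications of A by u, x, y, z have simple kernels:
   0, Au, Az, Ax, and A+ = Ax + Ay + Az is a direct sum; so the left Koszul complex
   of A is exact, with an explicit contraction.  A
   Hochschild cocycle f is a coboundary as soon as it vanishes on the Koszul tensors:
   f(s, c, v), with v in V_q and c arbitrary, is a cochain in s with values in the
   Koszul complex of Hom(A, A), and one descends from the largest q with V_q <> 0 to
   q = 0 with the contraction.  Hence classes in HH^1 and HH^4 are determined by their
   values on x, y, z and on u.x.z.y, and HH^7 = 0.

   The class A^{-4}(n) is represented by an explicit cup product of four twisted
   derivations.  The bracket with a derivation D is the Lie derivative, which commutes
   with the differential and is homotopic to 0 when D is inner, so that all brackets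
   can be read off the Koszul tensors. *)

Set Implicit Arguments.
Unset Strict Implicit.
Unset Printing Implicit Defensive.
Import GRing.Theory.
Local Open Scope ring_scope.

(** * Maps out of the presented algebra *)

(** No basis of A is ever written down. The presentation enters only through induction along right
    multiplication by x, y, z, and through the fact that three operators on a module N which satisfy
    the relations extend to a right module map from A to N. With N a product of copies of A or of a
    target algebra, this one principle yields the letter-stripping operators, the primitives of
    Koszul 1-cocycles, the algebra maps and the twisted derivations.

    Two ambiguities shape the rest. A class carries an arbitrary representative, so a bracket of
    classes involves an unknown inner derivation and an unknown coboundary, and explicit primitives
    must absorb both errors. A value on a Koszul tensor matters only modulo Koszul coboundaries: the
    bracket of L_n and I_m comes out as m y^(m+n) x - y^m x y^n, and the last term has to be removed
    because it lies in Ay. Linear independence goes the opposite way and needs functionals that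
    control coboundaries: algebra maps to k[X] in degree 1, and in degree 4 a twisted derivation
    into k[X] that sends Koszul coboundaries to constants. *)

Section CyclicModule.
Variables (k : fieldType) (N : lmodType k) (R : 'I_3 -> N -> N) (n0 : N).
Hypothesis R_lin : forall i, linear (R i).

(** [foldl] applies the first letter of a word first, so [R i] plays the role of right
    multiplication by the i-th generator. *)
Definition free_eval (p : free_alg k) : N :=
  \sum_(w <- msupp (p : {malg k[{fmonom 'I_3}]})) p@_w *: foldl (fun n i => R i n) n0 w.

Lemma free_evalEw (p : free_alg k) (d : {fset {fmonom 'I_3}}) :
  (msupp (p : {malg k[{fmonom 'I_3}]}) `<=` d)%fset ->
  free_eval p = \sum_(w <- d) p@_w *: foldl (fun n i => R i n) n0 w.
Proof.
move=> pd; apply/big_fset_incl => // w wd wp.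
by rewrite mcoeff_outdom // scale0r.
Qed.

Lemma free_eval_lin : linear free_eval.
Proof.
move=> c p q.
set d := (msupp (p : {malg k[{fmonom 'I_3}]}) `|` msupp (q : {malg k[{fmonom 'I_3}]}))%fset.
have pd : (msupp (p : {malg k[{fmonom 'I_3}]}) `<=` d)%fset by exact: fsubsetUl.
have qd : (msupp (q : {malg k[{fmonom 'I_3}]}) `<=` d)%fset by exact: fsubsetUr.
have rd : (msupp (c *: p + q : {malg k[{fmonom 'I_3}]}) `<=` d)%fset.
  by apply: (fsubset_trans (msuppD_le _ _)); apply: fsetSU; exact: msuppZ_le.
rewrite (free_evalEw pd) (free_evalEw qd) (free_evalEw rd).
rewrite scaler_sumr -big_split /=; apply: eq_bigr => w _.
by rewrite mcoeffD mcoeffZ scalerDl scalerA.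
Qed.

End CyclicModule.

Lemma malgUZ (k : fieldType) (c : k) (w : {fmonom 'I_3}) :
  << c *g w >> = c *: << w >> :> {malg k[{fmonom 'I_3}]}.
Proof. by apply/malgP => v; rewrite mcoeffZ !mcoeffU mulr_natr. Qed.

Lemma free_alg_ind (k : fieldType) (P : free_alg k -> Prop) :
  (forall c p q, P p -> P q -> P (c *: p + q)) -> P 1 ->
  (forall p i, P p -> P (p * gen k i)) -> forall p, P p.
Proof.
move=> Plin P1 Pg.
have P0 : P 0 by rewrite -[0](addNr (1 : free_alg k)) -scaleN1r; exact: Plin.
have PU (w : {fmonom 'I_3}) : P (mkmalgU w 1).
  case: w => s; elim/last_ind: s => [|s i IH].
    by have := P1; rewrite /= -[FMonom [::]]fmoneE.
  have := Pg _ i IH; congr P.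
  rewrite /gen [LHS]fgmulUU mulr1; congr (mkmalgU _ _).
  by apply/val_inj; rewrite /= fmM fmU cats1.
move=> p; rewrite [p]monalgE.
elim/big_rec: _ => // w q _ Pq.
rewrite malgUZ.
exact: (Plin).
Qed.

Lemma alg_pi_rel (k : fieldType) (F : algType k) (rels : seq F) r :
  r \in rels -> alg_pi rels r = 0.
Proof.
move=> rR; rewrite -(alg_pi0 rels); apply/alg_pi_eq; rewrite subr0.
apply/asboolP; exists [:: ((1, r), 1)]; last by rewrite big_seq1 mul1r mulr1.
by move=> t; rewrite inE => /eqP ->.
Qed.

Section IdealKernel.
Variables (k : fieldType) (F : algType k) (N : lmodType k) (g : 'I_3 -> F).
Variables (R : 'I_3 -> N -> N) (ev : F -> N).
Hypotheses (R_lin : forall i, linear (R i)) (ev_lin : linear ev).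
Hypothesis evM : forall p i, ev (p * g i) = R i (ev p).
Hypothesis F_ind : forall P : F -> Prop,
  (forall c p q, P p -> P q -> P (c *: p + q)) -> P 1 ->
  (forall p i, P p -> P (p * g i)) -> forall p, P p.
Hypothesis rel_xx : forall n, R (inord 0) (R (inord 0) n) + R (inord 0) (R (inord 1) n) = 0.
Hypothesis rel_xz : forall n, R (inord 2) (R (inord 0) n) = 0.
Hypothesis rel_zy : forall n, R (inord 1) (R (inord 2) n) = 0.

(** In a summand a * r * b the relator acts on [ev a] and gives 0 by the three relations; the right
    factor b is then absorbed by induction, since every [R j] fixes 0. *)
Lemma ideal_kernel p : p \in two_sided_ideal
   [:: g (inord 0) ^+ 2 + g (inord 1) * g (inord 0); g (inord 0) * g (inord 2);
       g (inord 2) * g (inord 1)] -> ev p = 0.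
Proof.
have R0 j : R j 0 = 0 by have := R_lin j (-1) 0 0; rewrite scaler0 addr0 scaleN1r addNr.
have evD a b : ev (a + b) = ev a + ev b by have := ev_lin 1 a b; rewrite !scale1r.
have ev0 : ev 0 = 0 by apply: (addrI (ev 0)); rewrite -evD !addr0.
move=> /asboolP[s sR ->].
rewrite (big_morph _ evD ev0) big_seq big1 // => -[[a r] b] /sR /=.
move=> rR; elim/F_ind: b => [c p1 p2 IH1 IH2||b i IH].
- by rewrite mulrDr -scalerAr ev_lin IH1 IH2 scaler0 addr0.
- rewrite mulr1; move: rR; rewrite !inE => /or3P[]/eqP ->.
  + by rewrite mulrDr evD expr2 !mulrA !evM rel_xx.
  + by rewrite !mulrA !evM rel_xz.
  + by rewrite !mulrA !evM rel_zy.
- by rewrite mulrA evM IH R0.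
Qed.
End IdealKernel.

Section CyclicModuleA.
Variables (k : fieldType) (N : lmodType k) (R : 'I_3 -> N -> N) (n0 : N).
Hypothesis R_lin : forall i, linear (R i).

Lemma free_evalB (p q : free_alg k) :
  free_eval R n0 (p - q) = free_eval R n0 p - free_eval R n0 q.
Proof.
have := free_eval_lin R n0 (-1) q p.
by rewrite !scaleN1r [- q + p]addrC [- _ + free_eval _ _ _]addrC.
Qed.

Lemma free_evalD (p q : free_alg k) :
  free_eval R n0 (p + q) = free_eval R n0 p + free_eval R n0 q.
Proof. by have := free_eval_lin R n0 1 p q; rewrite !scale1r. Qed.

Lemma free_eval0 : free_eval R n0 0 = 0.
Proof. by have := free_evalB 0 0; rewrite !subrr. Qed.

Lemma free_eval_mkmalgU (w : {fmonom 'I_3}) :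
  free_eval R n0 (mkmalgU w 1) = foldl (fun n i => R i n) n0 w.
Proof. by rewrite /free_eval msuppU1 big_seq_fset1 mcoeffUU scale1r. Qed.

Lemma free_eval1 : free_eval R n0 1 = n0.
Proof. by rewrite [LHS]free_eval_mkmalgU fm1. Qed.

Lemma free_evalMgen (p : free_alg k) i :
  free_eval R n0 (p * gen k i) = R i (free_eval R n0 p).
Proof.
have R0 j : R j 0 = 0 by have := R_lin j (-1) 0 0; rewrite scaler0 addr0 scaleN1r addNr.
have Rz c n : R i (c *: n) = c *: R i n by have := R_lin i c n 0; rewrite R0 !addr0.
rewrite [p]monalgE mulr_suml !(big_morph _ free_evalD free_eval0).
rewrite (big_morph (R i) (id1 := 0) (op1 := +%R)) //; last first.
  by move=> a b; have := R_lin i 1 a b; rewrite !scale1r.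
apply: eq_bigr => w _.
have evZ c (q : free_alg k) : free_eval R n0 (c *: q) = c *: free_eval R n0 q.
  by have := free_eval_lin R n0 c q 0; rewrite free_eval0 !addr0.
have -> : << p@_w *g w >> * gen k i = p@_w *: (<< w >> * gen k i) :> free_alg k.
  by rewrite malgUZ; apply/esym/scalerAl.
have -> : free_eval R n0 << p@_w *g w >> = p@_w *: free_eval R n0 << w >>.
  by rewrite malgUZ; apply: evZ.
rewrite evZ Rz; congr (_ *: _).
have -> : << w >> * gen k i = mkmalgU (mmul w (fmu i)) 1 :> free_alg k.
  by rewrite [LHS]fgmulUU mulr1.
by rewrite !free_eval_mkmalgU fmM fmU foldl_cat.
Qed.

Definition cyclic_map (a : algA k) : N := free_eval R n0 (alg_repr a).

Hypothesis rel_xx : forall n, R (inord 0) (R (inord 0) n) + R (inord 0) (R (inord 1) n) = 0.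
Hypothesis rel_xz : forall n, R (inord 2) (R (inord 0) n) = 0.
Hypothesis rel_zy : forall n, R (inord 1) (R (inord 2) n) = 0.

Lemma free_eval_ideal p : p \in two_sided_ideal (relators k) -> free_eval R n0 p = 0.
Proof.
apply: (ideal_kernel (R := R)) => //.
- exact: free_eval_lin.
- exact: free_evalMgen.
- exact: free_alg_ind.
Qed.

Lemma cyclic_map_pi p : cyclic_map (alg_pi _ p) = free_eval R n0 p.
Proof.
apply/eqP; rewrite -subr_eq0 -free_evalB; apply/eqP/free_eval_ideal.
by apply/alg_pi_eq; rewrite alg_reprK.
Qed.

Lemma cyclic_map_lin : linear cyclic_map.
Proof.
move=> c; elim/alg_quot_ind=> p; elim/alg_quot_ind=> q.
have -> : c *: (alg_pi _ p : algA k) + alg_pi _ q = alg_pi (relators k) (c *: p + q).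
  by rewrite alg_piD -alg_piZ.
by rewrite !cyclic_map_pi free_eval_lin.
Qed.

Lemma cyclic_map1 : cyclic_map 1 = n0.
Proof. by rewrite [1]/(alg_pi (relators k) 1) cyclic_map_pi free_eval1. Qed.

Lemma cyclic_mapM a i : cyclic_map (a * alg_pi _ (gen k i)) = R i (cyclic_map a).
Proof.
elim/alg_quot_ind: a => p.
by rewrite [_ * _]alg_piM !cyclic_map_pi free_evalMgen.
Qed.
End CyclicModuleA.

Section AlgebraFacts.
Variable k : fieldType.
Local Notation A := (algA k).
Local Notation x := (Ax k).
Local Notation y := (Ay k).
Local Notation z := (Az k).

Lemma algA_ind (P : A -> Prop) :
  (forall c a b, P a -> P b -> P (c *: a + b)) -> P 1 ->
  (forall a, P a -> P (a * x)) -> (forall a, P a -> P (a * y)) ->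
  (forall a, P a -> P (a * z)) -> forall a, P a.
Proof.
move=> Plin P1 Px Py Pz; elim/alg_quot_ind; elim/free_alg_ind => [c p q Pp Pq||p i Pp].
- by rewrite alg_piD -alg_piZ; apply: Plin.
- by [].
- rewrite -alg_piM; have [->|->|->] : [\/ i = inord 0, i = inord 1 | i = inord 2].
  + case: i => [[|[|[|//]]] i3]; [apply: Or31|apply: Or32|apply: Or33];
      by apply/val_inj; rewrite /= inordK.
  + exact: Px. + exact: Py. + exact: Pz.
Qed.

Lemma ux0 : (x + y) * x = 0.
Proof.
rewrite mulrDl [x * x]alg_piM [y * x]alg_piM.
by apply: (etrans (esym (alg_piD _ _ _))); apply: alg_pi_rel; rewrite -expr2 inE eqxx.
Qed.

Lemma xz0 : x * z = 0.
Proof.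
rewrite [_ * _]alg_piM; apply: alg_pi_rel.
by rewrite !inE; apply/or3P; apply: Or32; apply: eqxx.
Qed.

Lemma zy0 : z * y = 0.
Proof.
rewrite [_ * _]alg_piM; apply: alg_pi_rel.
by rewrite !inE; apply/or3P; apply: Or33; apply: eqxx.
Qed.

Variables (N : lmodType k) (Rx Ry Rz : N -> N) (n0 : N).
Hypotheses (Rx_lin : linear Rx) (Ry_lin : linear Ry) (Rz_lin : linear Rz).
Hypotheses (Rxx : forall n, Rx (Rx n) + Rx (Ry n) = 0)
  (Rxz : forall n, Rz (Rx n) = 0) (Rzy : forall n, Ry (Rz n) = 0).

Definition rmod_map : A -> N := cyclic_map (fun i : 'I_3 => nth Rx [:: Rx; Ry; Rz] i) n0.

Lemma rmod_mapP : [/\ linear rmod_map, rmod_map 1 = n0,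
  forall a, rmod_map (a * x) = Rx (rmod_map a),
  forall a, rmod_map (a * y) = Ry (rmod_map a)
  & forall a, rmod_map (a * z) = Rz (rmod_map a)].
Proof.
have Rlin (i : 'I_3) : linear (nth Rx [:: Rx; Ry; Rz] i) by case: i => [[|[|[|]]]].
have R1 n : nth Rx [:: Rx; Ry; Rz] (inord 0 : 'I_3) n = Rx n by rewrite inordK.
have R2 n : nth Rx [:: Rx; Ry; Rz] (inord 1 : 'I_3) n = Ry n by rewrite inordK.
have R3 n : nth Rx [:: Rx; Ry; Rz] (inord 2 : 'I_3) n = Rz n by rewrite inordK.
have relxx n : nth Rx [:: Rx; Ry; Rz] (inord 0 : 'I_3) (nth Rx [:: Rx; Ry; Rz] (inord 0 : 'I_3) n)
  + nth Rx [:: Rx; Ry; Rz] (inord 0 : 'I_3) (nth Rx [:: Rx; Ry; Rz] (inord 1 : 'I_3) n) = 0.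
  by rewrite !R1 R2.
have relxz n : nth Rx [:: Rx; Ry; Rz] (inord 2 : 'I_3)
  (nth Rx [:: Rx; Ry; Rz] (inord 0 : 'I_3) n) = 0 by rewrite R1 R3.
have relzy n : nth Rx [:: Rx; Ry; Rz] (inord 1 : 'I_3)
  (nth Rx [:: Rx; Ry; Rz] (inord 2 : 'I_3) n) = 0 by rewrite R3 R2.
split=> [||a|a|a].
- exact: cyclic_map_lin.
- exact: cyclic_map1.
- by rewrite -R1; apply: cyclic_mapM.
- by rewrite -R2; apply: cyclic_mapM.
- by rewrite -R3; apply: cyclic_mapM.
Qed.
End AlgebraFacts.

(** * The bar differential *)

Section BarCalculus.
Variables (k : fieldType) (A : algType k) (N : lmodType k).
Variables (la : A -> N -> N) (ra : N -> A -> N).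
Implicit Types (F G : seq A -> N) (s t r : seq A).

(** All faces of the bar differential except the first, with alternating signs that start at +. The
    first entry is turned into a parameter of F, so that identities follow by induction on the
    sequence. The bimodule N will be A itself or the functions from A to A. *)
Fixpoint bar_tail s F : N :=
  match s with
  | [::] => 0
  | a :: s' =>
      match s' with
      | [::] => ra (F [::]) a
      | b :: t => F (a * b :: t) - bar_tail s' (fun r => F (a :: r))
      end
  end.

Arguments bar_tail : simpl never.

Lemma bar_tail_seq1 a F : bar_tail [:: a] F = ra (F [::]) a.
Proof. by []. Qed.

Lemma bar_tail_cons2 a b t F :
  bar_tail (a :: b :: t) F = F (a * b :: t) - bar_tail (b :: t) (fun r => F (a :: r)).
Proof. by []. Qed.

Definition bar_tailE := (bar_tail_seq1, bar_tail_cons2).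

Definition bar_diff F s : N :=
  if s is a :: s' then la a (F s') - bar_tail s F else 0.

Definition mlin F : Prop := forall s t (c : k) a b,
  F (s ++ (c *: a + b) :: t) = c *: F (s ++ a :: t) + F (s ++ b :: t).
Definition reduced F : Prop := forall s t, F (s ++ 1 :: t) = 0.
Definition homog n F : Prop := forall s, size s != n -> F s = 0.

Lemma mlin_cons F a : mlin F -> mlin (fun r => F (a :: r)).
Proof. by move=> Fl s t; apply: (Fl (a :: s)). Qed.

Lemma reduced_cons F a : reduced F -> reduced (fun r => F (a :: r)).
Proof. by move=> F1 s t; apply: (F1 (a :: s)). Qed.

Lemma mlinD F G (c : k) : mlin F -> mlin G -> mlin (fun r => c *: F r + G r).
Proof.
by move=> Fl Gl s t d a b; rewrite Fl Gl !scalerDr !scalerA [c * d]mulrC addrACA.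
Qed.

Lemma mlin0 F s t : mlin F -> F (s ++ 0 :: t) = 0.
Proof. by move=> Fl; have := Fl s t (-1) 0 0; rewrite scaler0 addr0 scaleN1r addNr. Qed.

Lemma bar_tail_ext s F G :
  (forall r, size r = (size s).-1 -> F r = G r) -> bar_tail s F = bar_tail s G.
Proof.
elim: s F G => [//|a [|b t] IH] F G FG; first by rewrite !bar_tailE FG.
rewrite !bar_tail_cons2 FG //; congr (_ - _).
by apply: IH => r /= rt; apply: FG; rewrite /= rt.
Qed.

Hypothesis ra_lin : forall a, linear (ra^~ a).

Let ra0 a : ra 0 a = 0.
Proof. by have := ra_lin a (-1) 0 0; rewrite scaler0 addr0 scaleN1r addNr. Qed.

Lemma bar_tail_lin s (c : k) F G :
  bar_tail s (fun r => c *: F r + G r) = c *: bar_tail s F + bar_tail s G.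
Proof.
elim: s F G => [|a [|b t] IH] F G; first by rewrite /= scaler0 addr0.
  by rewrite !bar_tailE ra_lin.
rewrite !bar_tail_cons2 IH.
by rewrite opprD addrACA scalerBr.
Qed.

Lemma bar_tail0 s : bar_tail s (fun=> 0) = 0.
Proof. by elim: s => [|a [|b t] IH] //; rewrite !bar_tailE ?ra0 // IH subr0. Qed.

Lemma bar_tail_eq0 s F :
  (forall r, size r = (size s).-1 -> F r = 0) -> bar_tail s F = 0.
Proof. by move=> F0; rewrite (bar_tail_ext (G := fun=> 0)) ?bar_tail0. Qed.

Lemma bar_tailN s F : bar_tail s (fun r => - F r) = - bar_tail s F.
Proof.
have := bar_tail_lin s (-1) F (fun=> 0).
rewrite bar_tail0 addr0 scaleN1r => <-; apply: bar_tail_ext => r _.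
by rewrite addr0 scaleN1r.
Qed.

Lemma bar_tailD s F G :
  bar_tail s (fun r => F r + G r) = bar_tail s F + bar_tail s G.
Proof.
have := bar_tail_lin s 1 F G; rewrite scale1r => <-.
by apply: bar_tail_ext => r _; rewrite scale1r.
Qed.

Lemma bar_tailB s F G :
  bar_tail s (fun r => F r - G r) = bar_tail s F - bar_tail s G.
Proof. by rewrite bar_tailD bar_tailN. Qed.

Lemma bar_tail_sign s F :
  bar_tail s (fun r => (-1) ^+ size r *: F r) = - ((-1) ^+ size s *: bar_tail s F).
Proof.
have E n (v : N) : (-1) ^+ n *: v = - ((-1) ^+ n.+1 *: v) :> N.
  by rewrite exprS -scalerA scaleN1r opprK.
case: s => [|a s]; first by rewrite /= scaler0 oppr0.
rewrite -E -[RHS]addr0 -[X in _ = _ + X](bar_tail0 (a :: s)) -bar_tail_lin.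
by apply: bar_tail_ext => r ->; rewrite /= addr0.
Qed.

Hypothesis raA : forall n a b, ra (ra n a) b = ra n (a * b).

(** Up to sign the tail is the whole bar differential for the zero left action, so it squares to 0
    by itself. *)
Lemma bar_tail_bar_tail s F : bar_tail s (fun r => bar_tail r F) = 0.
Proof.
elim: s F => [|a [|b s] IH] F //; first by rewrite bar_tailE /= ra0.
rewrite bar_tail_cons2 /=; apply/eqP; rewrite subr_eq0; apply/eqP.
(* The subtracted double tail is 0 by induction; including it makes the two sides agree face by
   face. *)
transitivity (bar_tail (b :: s) (fun r => if r is c :: r' then F (a * c :: r') else ra (F [::]) a)
  - bar_tail (b :: s) (fun r => bar_tail r (fun r => F (a :: r)))).
  rewrite IH subr0; case: s {IH} => [|c s]; rewrite !bar_tailE /= ?raA //.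
  by rewrite mulrA; congr (_ - _); apply: bar_tail_ext => r _.
by rewrite -bar_tailB; apply: bar_tail_ext => -[|c r] _ //=; rewrite subr0.
Qed.

Hypothesis la_lin : forall a, linear (la a).
Hypothesis laA : forall a b n, la a (la b n) = la (a * b) n.
Hypothesis lara : forall a b n, la a (ra n b) = ra (la a n) b.

Let laB a m n : la a (m - n) = la a m - la a n.
Proof. by rewrite addrC -scaleN1r la_lin scaleN1r addrC. Qed.

Let la0 a : la a 0 = 0. Proof. by have := laB a 0 0; rewrite !subrr. Qed.

Lemma bar_tail_la s a F : bar_tail s (fun r => la a (F r)) = la a (bar_tail s F).
Proof.
elim: s F => [|b [|c t] IH] F; rewrite ?bar_tailE /= ?la0 //.
by rewrite IH laB.
Qed.

Lemma bar_diff_lin (c : k) F G s :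
  bar_diff (fun r => c *: F r + G r) s = c *: bar_diff F s + bar_diff G s.
Proof.
case: s => [|a s]; first by rewrite /= scaler0 addr0.
by rewrite /bar_diff bar_tail_lin la_lin opprD addrACA scalerBr.
Qed.

Lemma bar_diff_bar_diff F s : bar_diff (bar_diff F) s = 0.
Proof.
case: s => [//|a s]; rewrite {1}/bar_diff.
rewrite (bar_tail_ext (G := fun r => (if r is b :: r' then la b (F r') else 0) - bar_tail r F));
  last by case=> [|b r] _ //=; rewrite subr0.
rewrite bar_tailB bar_tail_bar_tail subr0.
case: s => [|b s]; rewrite !bar_tailE /=; first by rewrite la0 ra0 subr0.
rewrite bar_tail_la laB laA.
by rewrite subrr.
Qed.

Hypothesis la_linl : forall n c a b, la (c *: a + b) n = c *: la a n + la b n.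
Hypothesis la1 : forall n, la 1 n = n.
Hypothesis ra1 : forall n, ra n 1 = n.

(** A condition on the values of F and not on the action: when N consists of functions from A to A,
    the right action precomposes with a left multiplication, and is linear in the algebra element
    only at a linear map. *)
Definition ra_linear F := forall r c a b,
  ra (F r) (c *: a + b) = c *: ra (F r) a + ra (F r) b.

Lemma mlin_bar_tail F : mlin F -> ra_linear F -> mlin (fun s => bar_tail s F).
Proof.
move=> Fl Fr s t c a b; elim: s F Fl Fr => [|d s IH] F Fl Fr.
  case: t => [|e t]; rewrite /= !bar_tailE; first exact: Fr.
  rewrite mulrDl -scalerAl (Fl [::]) /=.
  rewrite (bar_tail_ext (G := fun r => c *: F (a :: r) + F (b :: r))); last by move=> r _; apply: (Fl [::]).
  by rewrite bar_tail_lin scalerBr opprD addrACA.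
have {}IH := IH _ (mlin_cons d Fl) (fun r => Fr (d :: r)).
case: s IH => [|e s] /= IH; rewrite !bar_tail_cons2.
  by rewrite IH mulrDr -scalerAr (Fl [::]) scalerBr opprD addrACA.
by rewrite IH (Fl (d * e :: s)) scalerBr opprD addrACA.
Qed.

Lemma mlin_bar_diff F : mlin F -> ra_linear F -> mlin (bar_diff F).
Proof.
move=> Fl Fr [|d s] t c a b.
  by rewrite /bar_diff /= (mlin_bar_tail Fl Fr [::]) la_linl scalerBr opprD addrACA.
by rewrite /bar_diff /= (mlin_bar_tail Fl Fr (d :: s)) Fl la_lin scalerBr opprD addrACA.
Qed.

Lemma bar_tail_1 F t : reduced F -> bar_tail (1 :: t) F = F t.
Proof.
move=> F1; case: t => [|b t]; rewrite bar_tailE ?ra1 // mul1r bar_tail_eq0 ?subr0 //.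
by move=> r _; apply: (F1 [::]).
Qed.

(** The two faces that multiply the entry 1 into its left and right neighbours cancel; every other
    face still contains 1. *)
Lemma bar_tail_reduced F a s t : reduced F -> bar_tail (a :: s ++ 1 :: t) F = 0.
Proof.
elim: s a F => [|b s IH] a F F1; rewrite bar_tail_cons2.
  rewrite bar_tail_1; last exact: reduced_cons.
  by rewrite mulr1 subrr.
rewrite IH; last exact: reduced_cons.
by rewrite (F1 (a * b :: s)) subr0.
Qed.

Lemma reduced_bar_diff F : reduced F -> reduced (bar_diff F).
Proof.
move=> F1 [|a s] t; rewrite /bar_diff /=.
  by rewrite bar_tail_1 // la1 subrr.
by rewrite bar_tail_reduced // F1 la0 subr0.
Qed.

Lemma homog_bar_diff n F : homog n F -> homog n.+1 (bar_diff F).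
Proof.
move=> Fn [//|a s]; rewrite /= eqSS => sn; rewrite Fn // la0.
by rewrite bar_tail_eq0 ?subr0 // => r rs; rewrite Fn // rs.
Qed.

End BarCalculus.

Arguments bar_tail : simpl never.

Section HochschildDiff.
Variables (k : fieldType) (A : algType k).
Local Notation hdif := (@bar_diff k A A *%R *%R).
Local Notation htail := (@bar_tail k A A *%R).
Implicit Types (f g : seq A -> A) (s t : seq A).

Lemma mulr_linl (a : A) : linear ( *%R^~ a).
Proof. by move=> c b d; rewrite mulrDl scalerAl. Qed.
Lemma mulr_linr (a : A) : linear ( *%R a).
Proof. by move=> c b d; rewrite mulrDr scalerAr. Qed.

Lemma hdif_cons f a s : hdif f (a :: s) = a * f s - htail (a :: s) f.
Proof. by []. Qed.

Lemma homog_hdif n f : homog n f -> homog n.+1 (hdif f).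
Proof. by apply: homog_bar_diff; [exact: mulr_linl|exact: mulr_linr]. Qed.

Lemma htail_sum n f s : size s = n.+1 ->
  \sum_(i < n) (-1) ^+ i.+1 * f (take i s ++ s`_i * s`_i.+1 :: drop i.+2 s)
    + (-1) ^+ n.+1 * (f (take n s) * s`_n) = - htail s f.
Proof.
elim: n f s => [|n IH] f [|a [|b t]] //.
  by move=> _; rewrite big_ord0 add0r expr1 mulN1r bar_tailE.
move=> [tn].
rewrite bar_tail_cons2 opprB -[htail (b :: t) _]opprK -IH; last by rewrite /= tn.
rewrite big_ord_recl /= expr1 mulN1r drop0 -addrA addrC [in RHS]opprD -sumrN.
congr (_ + _ + _).
  by apply: eq_bigr => i _; rewrite [in LHS]exprS mulN1r mulNr.
by rewrite [in LHS]exprS mulN1r mulNr.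
Qed.

Lemma hdiffE n f : homog n f -> hdiff n f = hdif f.
Proof.
move=> fn; apply/funext => s; rewrite /hdiff; case: eqP => [sn|/eqP sn].
  by rewrite -addrA htail_sum //; case: s sn.
by rewrite (homog_hdif fn).
Qed.

Lemma is_cochainP n f : is_cochain n f <-> [/\ homog n f, mlin f & reduced f].
Proof. by split=> -[]. Qed.

Lemma is_cochain_hdiff n f : is_cochain n f -> is_cochain n.+1 (hdiff n f).
Proof.
move=> /is_cochainP[fn fl f1]; rewrite (hdiffE fn); apply/is_cochainP; split.
- exact: homog_hdif.
- apply: mlin_bar_diff => //; [exact: mulr_linl|exact: mulr_linr|..].
  + by move=> *; rewrite mulr_linl.
  + by move=> *; apply: mulr_linr.
- by apply: reduced_bar_diff => //; [exact: mulr_linl|exact: mulr_linr|exact: mul1r|exact: mulr1].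
Qed.

Lemma hdiff_hdiff n f : is_cochain n f -> hdiff n.+1 (hdiff n f) = 0.
Proof.
move=> fc; have /is_cochainP[dn _ _] := is_cochain_hdiff fc.
have /is_cochainP[fn _ _] := fc.
rewrite (hdiffE dn) (hdiffE fn); apply/funext => s.
apply: bar_diff_bar_diff; [exact: mulr_linl|by move=> *; rewrite mulrA|exact: mulr_linr|..].
  by move=> *; rewrite mulrA.
by move=> *; rewrite mulrA.
Qed.

End HochschildDiff.

(** * Lie derivatives and the Gerstenhaber bracket with a derivation *)

Section LieDerivative.
Variables (k : fieldType) (A : algType k).
Implicit Types (f g h F G : seq A -> A) (s t r : seq A).
Local Notation hdif := (@bar_diff k A A *%R *%R).
Local Notation htail := (@bar_tail k A A *%R).

Fixpoint subst_sum (D : A -> A) s F : A :=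
  if s is a :: t then F (D a :: t) + subst_sum D t (fun r => F (a :: r)) else 0.

(** The circle product of F with the 0-cochain a: the contraction in Cartan's formula. *)
Fixpoint insert_sum (a : A) s F : A :=
  if s is b :: t then F (a :: s) - insert_sum a t (fun r => F (b :: r)) else F [:: a].

Definition lie (D : A -> A) F s : A := D (F s) - subst_sum D s F.

Lemma subst_sumB D s F G :
  subst_sum D s (fun r => F r - G r) = subst_sum D s F - subst_sum D s G.
Proof.
elim: s F G => [|a s IH] F G /=; first by rewrite subrr.
by rewrite IH opprD addrACA.
Qed.

Lemma subst_sum_mull D s a F : subst_sum D s (fun r => a * F r) = a * subst_sum D s F.
Proof. by elim: s F => [|b s IH] F /=; rewrite ?mulr0 // IH mulrDr. Qed.

Lemma subst_sum_lin D s (c : k) F G :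
  subst_sum D s (fun r => c *: F r + G r) = c *: subst_sum D s F + subst_sum D s G.
Proof.
elim: s F G => [|a s IH] F G /=; first by rewrite scaler0 addr0.
by rewrite IH scalerDr addrACA.
Qed.

Lemma subst_sum_derD D E D' s F : mlin F -> (forall b, D' b = D b + E b) ->
  subst_sum D' s F = subst_sum D s F + subst_sum E s F.
Proof.
move=> Fl DE; elim: s F Fl => [|a s IH] F Fl /=; first by rewrite addr0.
have -> : F (D' a :: s) = F (D a :: s) + F (E a :: s).
  by have := Fl [::] s 1 (D a) (E a); rewrite !scale1r DE.
by rewrite IH; [rewrite addrACA|apply: mlin_cons].
Qed.

Lemma homog_subst_sum D n F : homog n F -> homog n (subst_sum D ^~ F).
Proof.
move=> Fn s; elim: s n F Fn => [//|a s IH] n F Fn sn /=; rewrite Fn // add0r.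
case: n Fn sn => [|n] Fn sn.
  apply: (IH (size s).+1); last by rewrite neq_ltn leqnn.
  by move=> r _; apply: Fn.
by apply: (IH n) => // r rn; apply: Fn.
Qed.

Lemma insert_sumB a s F G :
  insert_sum a s (fun r => F r - G r) = insert_sum a s F - insert_sum a s G.
Proof.
elim: s F G => [//|b s IH] F G /=.
by rewrite IH !opprD addrACA.
Qed.

Lemma insert_sum_mull a s b F : insert_sum a s (fun r => b * F r) = b * insert_sum a s F.
Proof. by elim: s F => [//|c s IH] F /=; rewrite IH mulrBr. Qed.

Let tailB s F G : htail s (fun r => F r - G r) = htail s F - htail s G.
Proof. exact: (bar_tailB (@mulr_linl _ _)). Qed.

Section Derivation.
Variable D : A -> A.
Hypotheses (D_lin : linear D) (DM : forall a b, D (a * b) = D a * b + a * D b).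

Let DB a b : D (a - b) = D a - D b.
Proof. by have := D_lin (-1) b a; rewrite !scaleN1r [- b + a]addrC [- _ + D a]addrC. Qed.

Let D0 : D 0 = 0. Proof. by have := DB 0 0; rewrite !subrr. Qed.

Let D1 : D 1 = 0.
Proof. by apply: (addrI (D 1)); rewrite addr0 -{3}[1]mulr1 DM mulr1 mul1r. Qed.

(** A face multiplies two neighbours, and D of their product is the sum of the substitutions at
    either neighbour; on the last face the product rule is applied to a value of F times the last
    entry. *)
Lemma htail_lie s F : mlin F ->
  htail s (lie D F) = D (htail s F) - subst_sum D s (fun r => htail r F).
Proof.
elim: s F => [|a [|b t] IH] F Fl.
- by rewrite /= D0 subr0.
- by rewrite !bar_tailE /lie /= bar_tailE subr0 DM addr0 addrK.
- have {}IH := IH _ (mlin_cons a Fl).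
  rewrite [LHS]bar_tail_cons2.
  have -> : (fun r => lie D F (a :: r))
      = (fun r => lie D (fun r => F (a :: r)) r - F (D a :: r)).
    by apply/funext => r; rewrite /lie /= opprD [- _ - _]addrC addrA.
  rewrite tailB IH /lie /= !bar_tail_cons2 DB.
  have -> : (fun r => htail [:: a, b & r] F)
    = (fun r => F (a * b :: r) - htail (b :: r) (fun r => F (a :: r))) by [].
  rewrite subst_sumB DM.
  have -> : F (D a * b + a * D b :: t) = F (D a * b :: t) + F (a * D b :: t).
    by have := Fl [::] t 1 (D a * b) (a * D b); rewrite !scale1r.
  set X1 := D (F _); set X2 := F _; set X3 := F _; set X4 := subst_sum _ _ _.
  set X5 := D (htail _ _); set X6 := htail _ _; set X7 := subst_sum _ _ _.
  set X8 := htail _ _.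
  rewrite !opprD !opprK !addrA.
  by rewrite [LHS](ACl (1*5*2*8*3*6*4*7)).
Qed.

Lemma hdif_lie F s : mlin F -> hdif (lie D F) s = lie D (hdif F) s.
Proof.
move=> Fl; case: s => [|a s]; first by rewrite /lie /= D0 subr0.
rewrite hdif_cons htail_lie // [in RHS]/lie /= DB DM.
have -> : (fun r => hdif F (a :: r)) = (fun r => a * F r - htail (a :: r) F) by [].
rewrite subst_sumB subst_sum_mull /lie mulrBr !opprD !opprK !addrA.
by rewrite [RHS](ACl (1*4*2*6*3*5*7)) /= subrr add0r.
Qed.

Lemma mlin_lie F : mlin F -> mlin (lie D F).
Proof.
move=> Fl s t c a b; rewrite /lie Fl D_lin.
suff -> : forall F, mlin F -> subst_sum D (s ++ (c *: a + b) :: t) F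
    = c *: subst_sum D (s ++ a :: t) F + subst_sum D (s ++ b :: t) F.
- by rewrite opprD addrACA scalerBr.
- by [].
elim: s => [|d s IH] {Fl}F Fl /=.
  rewrite D_lin (Fl [::]) /=.
  have -> : (fun r => F (c *: a + b :: r)) = (fun r => c *: F (a :: r) + F (b :: r)).
    by apply/funext => r; apply: (Fl [::]).
  by rewrite subst_sum_lin addrACA scalerDr.
rewrite (Fl (D d :: s)) IH; last exact: mlin_cons.
by rewrite addrACA scalerDr.
Qed.

Lemma reduced_lie F : mlin F -> reduced F -> reduced (lie D F).
Proof.
move=> Fl F1 s t; rewrite /lie F1 D0 sub0r.
suff -> : forall F, mlin F -> reduced F -> subst_sum D (s ++ 1 :: t) F = 0 by rewrite ?oppr0.
elim: s => [|d s IH] {Fl F1}F Fl F1 /=.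
  rewrite D1 (mlin0 [::] t Fl) add0r.
  have -> : (fun r => F (1 :: r)) = (fun=> 0) by apply/funext => r; apply: (F1 [::]).
  by elim: t => //= a t IH; rewrite add0r.
by rewrite (F1 (D d :: s)) IH ?addr0 //; [apply: mlin_cons|apply: reduced_cons].
Qed.

Lemma homog_lie n F : homog n F -> homog n (lie D F).
Proof. by move=> Fn s sn; rewrite /lie Fn // D0 sub0r (homog_subst_sum _ Fn) ?oppr0. Qed.

Lemma cochain_lie n F : is_cochain n F -> is_cochain n (lie D F).
Proof.
move=> /is_cochainP[Fn Fl F1]; apply/is_cochainP; split.
- exact: homog_lie.
- exact: mlin_lie.
- exact: reduced_lie.
Qed.

Lemma hdiff_lie n F : is_cochain n F -> hdiff n (lie D F) = lie D (hdiff n F).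
Proof.
move=> Fc; have /is_cochainP[Fn Fl F1] := Fc.
have /is_cochainP[Ln _ _] := cochain_lie Fc.
by rewrite !hdiffE //; apply/funext => s; apply: hdif_lie.
Qed.

Lemma lieD F G s : lie D (fun r => F r + G r) s = lie D F s + lie D G s.
Proof.
rewrite /lie (_ : D (F s + G s) = D (F s) + D (G s)); last first.
  by have := D_lin 1 (F s) (G s); rewrite !scale1r.
have := subst_sum_lin D s 1 F G; rewrite scale1r.
have -> : (fun r => 1 *: F r + G r) = (fun r => F r + G r).
  by apply/funext => r; rewrite scale1r.
by move=> ->; rewrite opprD addrACA.
Qed.

End Derivation.

Section Inner.
Variable a : A.
Let D (b : A) := a * b - b * a.

(** Inserting a before or after an entry b and multiplying gives a b and b a with opposite signs,
    hence F with the commutator at that place. The remaining faces cancel between the two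
    composites, except for the product with a at the right end. *)
Lemma htail_insert s F : mlin F ->
  insert_sum a s (fun r => htail r F) + htail s (fun r => insert_sum a r F)
  = subst_sum D s F + F s * a.
Proof.
have FB b c t : forall F, mlin F -> F (b - c :: t) = F (b :: t) - F (c :: t).
  by move=> {}F Fl; have := Fl [::] t (-1) c b; rewrite !scaleN1r /= [- c + b]addrC [- _ + F _]addrC.
elim: s F => [|b s IH] F Fl.
  by rewrite /= bar_tailE addr0 add0r.
have {}IH := IH _ (mlin_cons b Fl).
case: s IH => [|c t] IH.
  rewrite /= !bar_tailE /D FB //= !opprD !opprK !addrA addr0.
  by rewrite [LHS](ACl (1*3*4*(2*5))) /= addNr addr0.
have E1 : insert_sum a [:: b, c & t] (fun r => htail r F)
    = F [:: a * b, c & t] - (F [:: a, b * c & t] - htail (c :: t) (fun r => F [:: a, b & r]))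
      - (F [:: b * a, c & t] - htail [:: a, c & t] (fun r => F (b :: r))
         - (insert_sum a t (fun r => F (b * c :: r))
            - insert_sum a t (fun r => htail (c :: r) (fun r => F (b :: r))))).
  by rewrite -insert_sumB.
have E2 : htail [:: b, c & t] (fun r => insert_sum a r F)
    = F [:: a, b * c & t] - insert_sum a t (fun r => F (b * c :: r))
      - (htail (c :: t) (fun r => F [:: a, b & r])
         - htail (c :: t) (fun r => insert_sum a r (fun r => F (b :: r)))).
  by rewrite -tailB.
rewrite E1 E2 -[subst_sum _ _ _]/(F [:: D b, c & t] + subst_sum D (c :: t) (fun r => F (b :: r))).
rewrite -[RHS]addrA -IH [insert_sum a (c :: t) _]/= /D FB //.
rewrite !opprD !opprK !addrA.
by rewrite [LHS](ACl (1*4*5*6*8*12*(9*2)*(3*11)*(7*10))) /= !subrr !addr0.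
Qed.

Lemma hdif_insert F b s : mlin F -> hdif (fun r => insert_sum a r F) (b :: s)
  = a * F (b :: s) - F (b :: s) * a - subst_sum D (b :: s) F
    - insert_sum a (b :: s) (hdif F).
Proof.
move=> Fl; apply/eqP; rewrite -subr_eq0 opprB addrCA.
have -> : insert_sum a (b :: s) (hdif F) = a * F (b :: s) - b * insert_sum a s F
    - insert_sum a (b :: s) (fun r => htail r F).
  have -> : insert_sum a (b :: s) (hdif F)
    = hdif F [:: a, b & s] - insert_sum a s (fun r => b * F r - htail (b :: r) F) by [].
  have -> : insert_sum a (b :: s) (fun r => htail r F)
    = htail [:: a, b & s] F - insert_sum a s (fun r => htail (b :: r) F) by [].
  rewrite insert_sumB insert_sum_mull hdif_cons; move: (htail _ _) => X.
  rewrite !opprD !opprK !addrA.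
  by rewrite [LHS](ACl (1*3*2*4)).
have := htail_insert (b :: s) Fl; rewrite hdif_cons.
move: (insert_sum a (b :: s) _) (htail _ _) (subst_sum _ _ _) => I T S IT.
have {IT}-> : I = S + F (b :: s) * a - T by rewrite -IT addrK.
move: (insert_sum _ _ _) (F _) => J f; rewrite !opprD !opprK !addrA.
apply/eqP; rewrite [LHS](ACl ((1*8)*(6*2)*(10*3)*(9*4)*(5*7))) /=.
by rewrite !subrr !addr0.
Qed.

Lemma mlin_insert F : mlin F -> mlin (fun s => insert_sum a s F).
Proof.
move=> Fl s t c v w; elim: s F Fl => [|b s IH] F Fl /=.
  have -> : (fun r => F (c *: v + w :: r)) = (fun r => c *: F (v :: r) + F (w :: r)).
    by apply/funext => r; apply: (Fl [::]).
  have lin : forall G H, insert_sum a t (fun r => c *: G r + H r)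
      = c *: insert_sum a t G + insert_sum a t H.
    elim: t => [//|d t IHt] G H /=.
    by rewrite IHt opprD addrACA scalerBr.
  by rewrite (Fl [:: a]) /= lin opprD addrACA scalerBr.
rewrite (Fl (a :: b :: s)) IH; last exact: mlin_cons.
by rewrite opprD addrACA scalerBr.
Qed.

Lemma insert_reduced F : reduced F -> reduced (fun s => insert_sum a s F).
Proof.
move=> F1 s t; elim: s F F1 => [|b s IH] F F1 /=; last first.
  by rewrite (F1 (a :: b :: s)) IH ?subr0 //; apply: reduced_cons.
have -> : (fun r => F (1 :: r)) = (fun=> 0) by apply/funext => r; apply: (F1 [::]).
rewrite (F1 [:: a]) sub0r; suff -> : insert_sum a t (fun=> 0) = 0 by rewrite oppr0.
by elim: t => //= b t ->; rewrite subr0.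
Qed.

Lemma insert_homog n F : homog n.+1 F -> homog n (fun s => insert_sum a s F).
Proof.
move=> Fn s; elim: s n F Fn => [|b s IH] n F Fn sn /=; first by rewrite Fn.
rewrite Fn // sub0r; case: n Fn sn => [|n] Fn sn.
  suff E : forall G, (forall c r, G (c :: r) = 0) -> insert_sum a s G = 0.
    by rewrite E ?oppr0 // => c r; rewrite Fn.
  by elim: s {IH sn} => [|c s IH] G G0 /=; rewrite G0 // IH ?subr0.
by rewrite (IH n) ?oppr0 // => r rn; apply: Fn.
Qed.

Lemma cochain_insert n F : is_cochain n.+1 F -> is_cochain n (fun s => insert_sum a s F).
Proof.
move=> /is_cochainP[Fn Fl F1]; apply/is_cochainP; split.
- exact: insert_homog.
- exact: mlin_insert.
- exact: insert_reduced.
Qed.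

(* Cartan's formula for an inner derivation. *)
Lemma hdiff_insert n F : is_cochain n.+1 F -> hdiff n.+1 F = 0 ->
  lie D F = hdiff n (fun s => insert_sum a s F).
Proof.
move=> Fc F0; have /is_cochainP[Fn Fl _] := Fc.
have /is_cochainP[In _ _] := cochain_insert Fc.
rewrite (hdiffE In); apply/funext => -[|b s].
  by rewrite /lie /D /= Fn // mulr0 mul0r !subr0.
rewrite hdif_insert // -(hdiffE Fn) F0.
suff -> : insert_sum a (b :: s) 0 = 0 by rewrite subr0.
by elim: (b :: s) => //= c t IH; rewrite -[X in _ - X]/(insert_sum a t 0) IH subr0.
Qed.
End Inner.

Lemma subst_sumE f F s :
  \sum_(i < size s) F (take i s ++ f (take 1 (drop i s)) :: drop (i + 1) s)
  = subst_sum (fun b => f [:: b]) s F.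
Proof.
elim: s F => [|a s IH] F; first by rewrite big_ord0.
rewrite big_ord_recl /= drop0 take0 -[in RHS]IH; congr (F (f _ :: _) + _).
Qed.

Section Bracket.
Variables (f g : seq A -> A) (n : nat).
Hypotheses (fc : is_cochain 1 f) (gc : is_cochain n g).
Let D b := f [:: b].

Lemma gcirc_subst : gcirc n 1 g f = subst_sum D ^~ g.
Proof.
have [gn gl _] := gc; have [fn fl _] := fc.
apply/funext => s; rewrite /gcirc fct_sumE.
transitivity (\sum_(i < n) g (take i s ++ f (take 1 (drop i s)) :: drop (i + 1) s)).
  apply: eq_bigr => i _.
  rewrite -[LHS]/((-1) ^+ (2 * i) *: ginsert 1 i g f s) exprM sqrrN expr1n.
  by rewrite expr1n scale1r.
(* For a wrong length, an index beyond the end of s puts [f [::]], which is 0, into g; any smaller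
   index evaluates g at a sequence of wrong length. *)
have [<-|sn] := eqVneq (size s) n; last first.
  rewrite (homog_subst_sum _ gn) // big1 // => i _.
  have [si|si] := leqP (size s) i.
    by rewrite (drop_oversize si) fn // mlin0.
  by rewrite gn // size_cat /= size_drop size_takel ?(ltnW si) // addn1 subnSK // subnKC // ltnW.
exact: subst_sumE.
Qed.

Lemma gbracket_lie : gbracket 1 n f g = lie D g.
Proof.
have [gn gl _] := gc; have [fn fl _] := fc.
apply/funext => s; rewrite /gbracket gcirc_subst.
rewrite -[LHS]/(gcirc 1 n f g s - (-1) ^+ (2 * n.+1) *: subst_sum D s g).
rewrite exprM sqrrN expr1n expr1n scale1r /lie; congr (_ - _).
rewrite /gcirc big_ord1 muln0 expr0 scale1r /ginsert /= take0 drop0 add0n /D.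
have [sn|sn] := eqVneq (size s) n; first by rewrite -sn take_size drop_size.
rewrite (gn s) // (mlin0 [::] [::] fl).
have [sn'|sn'] := leqP (size s) n.
  by rewrite (take_oversize sn') gn // (mlin0 [::] _ fl).
by rewrite fn //= size_drop eqSS subn_eq0 -ltnNge.
Qed.

Lemma gbracketC : gbracket n 1 g f = - gbracket 1 n f g.
Proof.
by rewrite /gbracket (mulnC n.+1) !exprM sqrrN !expr1n !scale1r opprB.
Qed.
End Bracket.

Lemma cocycle1_derivation f : is_cochain 1 f -> hdiff 1 f = 0 ->
  linear (fun b => f [:: b]) /\ (forall a b, f [:: a * b] = f [:: a] * b + a * f [:: b]).
Proof.
move=> fc f0; have [fn fl _] := fc; split=> [c a b|a b]; first exact: (fl [::] [::]).
move: f0; rewrite hdiffE // => /(congr1 (@^~ [:: a; b])).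
rewrite hdif_cons !bar_tailE opprB addrA => /eqP; rewrite subr_eq0 => /eqP <-.
by rewrite addrC.
Qed.

(** * Hochschild classes and the bracket of arbitrary representatives *)

Lemma hcocycleP n f : reflect (is_cochain n f /\ hdiff n f = 0) (f \in hcocycle n).
Proof. exact: asboolP. Qed.

Lemma hcoboundaryP n f :
  reflect (exists2 h, is_cochain n h & f = hdiff n h) (f \in hcoboundary n.+1).
Proof. exact: asboolP. Qed.

Lemma hdiff_cocycle n h : is_cochain n h -> hdiff n h \in hcocycle n.+1.
Proof.
by move=> hc; apply/hcocycleP; split; [apply: is_cochain_hdiff|apply: hdiff_hdiff].
Qed.

Lemma hh_classE n f (fc : f \in hcocycle n) : hh_class n f = hh_pi (HCocycle fc).
Proof. by congr hh_pi; apply/val_inj; rewrite val_insubd fc. Qed.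

Lemma hh_class_eq n f g : f \in hcocycle n -> g \in hcocycle n ->
  (hh_class n f = hh_class n g) <-> (f - g \in hcoboundary n).
Proof. by move=> fc gc; rewrite (hh_classE fc) (hh_classE gc) hh_pi_eq. Qed.

Lemma hh_repr_cocycle n (c : HH A n) : val (hh_repr c) \in hcocycle n.
Proof. exact: valP. Qed.

Lemma hh_class_repr n (c : HH A n) : hh_class n (val (hh_repr c)) = c.
Proof.
rewrite (hh_classE (hh_repr_cocycle c)) -[RHS]hh_reprK; congr hh_pi.
exact: val_inj.
Qed.

Lemma hh_repr_class n f : f \in hcocycle n.+1 ->
  exists2 h, is_cochain n h & val (hh_repr (hh_class n.+1 f)) = f + hdiff n h.
Proof.
move=> fc; have := hh_class_repr (hh_class n.+1 f).
move/(hh_class_eq (hh_repr_cocycle _) fc)/hcoboundaryP => [h hc E].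
by exists h => //; rewrite -E addrC subrK.
Qed.

Lemma hh_classD n f g : f \in hcocycle n -> g \in hcocycle n ->
  hh_class n (f + g) = hh_class n f + hh_class n g.
Proof.
move=> fc gc; have fgc : f + g \in hcocycle n by apply: rpredD.
rewrite (hh_classE fc) (hh_classE gc) (hh_classE fgc) -hh_piD; congr hh_pi.
exact: val_inj.
Qed.

Lemma hh_classZ n (c : k) f : f \in hcocycle n -> hh_class n (c *: f) = c *: hh_class n f.
Proof.
move=> fc; have cfc : c *: f \in hcocycle n by apply: rpredZ.
rewrite (hh_classE fc) (hh_classE cfc) [RHS]hh_piZ; congr hh_pi.
exact: val_inj.
Qed.

Lemma hh_class0 n : hh_class n (0 : seq A -> A) = 0.
Proof. by rewrite -[0 : seq A -> A](scale0r 0) hh_classZ ?scale0r // rpred0. Qed.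

Lemma lie_cocycle n f g : f \in hcocycle 1 -> g \in hcocycle n ->
  lie (fun b => f [:: b]) g \in hcocycle n.
Proof.
move=> /hcocycleP[fc f0] /hcocycleP[gc g0]; have [Dl DM] := cocycle1_derivation fc f0.
apply/hcocycleP; split; first exact: cochain_lie.
rewrite hdiff_lie // g0; apply/funext => s.
have D0 : f [:: 0] = 0 by case: fc => _ fl _; apply: (mlin0 [::] [::] fl).
suff E : forall s, subst_sum (fun b => f [:: b]) s 0 = 0.
  by rewrite -[LHS]/(f [:: 0] - subst_sum _ s 0) E D0 subrr.
by elim=> //= a t IH; rewrite -[X in _ + X]/(subst_sum _ t 0) IH addr0.
Qed.

(** The chosen representatives are f plus an inner derivation and g plus the differential of h. The
    Lie derivative along the former commutes with the differential, which handles h; Cartan's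
    formula handles the inner part acting on g. *)
Lemma hh_bracket_class n f g : f \in hcocycle 1 -> g \in hcocycle n.+1 ->
  hh_bracket (hh_class 1 f) (hh_class n.+1 g) = hh_class n.+1 (lie (fun b => f [:: b]) g)
    :> HH A n.+1.
Proof.
move=> fc gc; set f' := val (hh_repr (hh_class 1 f)); set g' := val (hh_repr (hh_class n.+1 g)).
have f'c : f' \in hcocycle 1 := hh_repr_cocycle _.
have g'c : g' \in hcocycle n.+1 := hh_repr_cocycle _.
have /hcocycleP[f'cc f'0] := f'c; have /hcocycleP[g'cc g'0] := g'c.
rewrite [LHS]/(hh_class n.+1 (gbracket 1 n.+1 f' g')) gbracket_lie //.
apply/hh_class_eq; [exact: lie_cocycle|exact: lie_cocycle|].
have [a _ f'E] := hh_repr_class fc; have [h hc g'E] := hh_repr_class gc.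
have [D'l D'M] := cocycle1_derivation f'cc f'0.
have /hcocycleP[gcc g0] := gc.
(* The differential of the 0-cochain a sends v to v a - a v, so the inner derivation written as al v
   - v al has the opposite sign. *)
apply/hcoboundaryP; set al := - a [::].
exists (1 *: lie (fun b => f' [:: b]) h + (fun s => insert_sum al s g)).
  by apply: cochain_lin; [apply: cochain_lie|apply: cochain_insert].
rewrite hdiff_lin scale1r hdiff_lie // -hdiff_insert //; apply/funext => s.
have -> : g' = fun r => g r + hdiff n h r by rewrite /g' g'E.
have [_ gl _] := gcc.
have f'D b : f' [:: b] = f [:: b] + (al * b - b * al).
  rewrite /f' f'E -[LHS]/(f [:: b] + hdiff 0 a [:: b]); congr (_ + _).
  rewrite /hdiff /= big_ord0 addr0 expr1 mulN1r /al mulrN mulNr opprK addrC.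
  by [].
rewrite -[LHS]/(lie _ _ s - lie _ g s) lieD //.
rewrite -[RHS]/(lie _ (hdiff n h) s + lie _ g s) addrAC addrC; congr (_ + _).
rewrite /lie (subst_sum_derD _ gl f'D) f'D opprD addrACA addrC addrA.
by rewrite addNr add0r.
Qed.

Lemma hh_bracketC (a : HH A 1) (b : HH A 4) : hh_bracket b a = - hh_bracket a b :> HH A 4.
Proof.
have ac := hh_repr_cocycle a; have bc := hh_repr_cocycle b.
have /hcocycleP[acc _] := ac; have /hcocycleP[bcc _] := bc.
have E : hh_bracket a b = hh_class 4 (gbracket 1 4 (val (hh_repr a)) (val (hh_repr b))) by [].
rewrite E [LHS]/(hh_class 4 (gbracket 4 1 _ _)) gbracketC gbracket_lie //.
by have := hh_classZ (-1) (lie_cocycle ac bc); rewrite !scaleN1r.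
Qed.

Lemma cohomologous_on n (B : seq (seq A)) f' f (psi : seq A -> A) :
  (forall g, g \in hcocycle n.+1 -> (forall v, v \in B -> g v = 0) -> g \in hcoboundary n.+1) ->
  f' \in hcocycle n.+1 -> f \in hcocycle n.+1 -> is_cochain n psi ->
  (forall v, v \in B -> f' v - hdiff n psi v = f v) -> f' - f \in hcoboundary n.+1.
Proof.
move=> inj f'c fc psic E.
suff /hcoboundaryP[h hc hE] : f' - f - hdiff n psi \in hcoboundary n.+1.
  apply/hcoboundaryP; exists (1 *: psi + h); first exact: cochain_lin.
  by rewrite hdiff_lin scale1r -hE [RHS]addrC subrK.
apply: inj; first by rewrite !rpredB // hdiff_cocycle.
move=> v vB; rewrite -[LHS]/(f' v - f v - hdiff n psi v) -(E v vB).
by rewrite opprB addrCA subrr addr0 subrr.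
Qed.

End LieDerivative.

(** * Exactness of the Koszul complex *)

Section ParamCochains.
Variables (k : fieldType) (A : algType k).
Implicit Types (f : seq A -> A) (F G : seq A -> A -> A) (s t v : seq A).
Local Notation hdif := (@bar_diff k A A *%R *%R).
Local Notation htail := (@bar_tail k A A *%R).

Let subfE (p q : A -> A) c : (p - q) c = p c - q c. Proof. by []. Qed.

Definition pla (a : A) (phi : A -> A) : A -> A := fun c => a * phi c.
(** This action reproduces the face of f(s, c, v) that multiplies the last entry of s into c. *)
Definition pra (phi : A -> A) (a : A) : A -> A := fun c => phi (a * c).
Local Notation pdif := (@bar_diff k A (A -> A) pla pra).
Local Notation ptail := (@bar_tail k A (A -> A) pra).

Lemma pla_lin a : linear (pla a).
Proof. by move=> c p q; apply/funext => d; apply: mulr_linr. Qed.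
Lemma pra_lin a : linear (pra^~ a).
Proof. by []. Qed.
Lemma plaA a b p : pla a (pla b p) = pla (a * b) p.
Proof. by apply/funext => d; rewrite /pla mulrA. Qed.
Lemma praA p a b : pra (pra p a) b = pra p (a * b).
Proof. by apply/funext => d; rewrite /pra mulrA. Qed.

Definition param n F : Prop :=
  [/\ @homog k A _ n F, @mlin k A _ F, @reduced k A _ F & forall s, linear (F s)].

Lemma paramD n F G (e : k) : param n F -> param n G -> param n (fun s => e *: F s + G s).
Proof.
move=> [Fn Fl F1 Fr] [Gn Gl G1 Gr]; split.
- by move=> s sn; rewrite Fn ?Gn // scaler0 addr0.
- exact: mlinD.
- by move=> s t; rewrite F1 G1 scaler0 addr0.
- move=> s c a b; rewrite [LHS]/(e *: F s _ + G s _) Fr Gr.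
  by rewrite [F s]lock [G s]lock !scalerDr !scalerA [e * c]mulrC addrACA.
Qed.

Lemma param0 n : param n (fun=> 0).
Proof.
by split=> [//|s t c a b|//|s c a b]; rewrite scaler0 addr0.
Qed.

Lemma param_sign n F : param n F -> param n (fun s => (-1) ^+ size s *: F s).
Proof.
move=> Fp; have := paramD ((-1) ^+ n) Fp (param0 n); congr param.
apply/funext => s; rewrite addr0; have [-> //|sn] := eqVneq (size s) n.
by case: Fp => -> // _ _ _; rewrite !scaler0.
Qed.

Lemma param_pdif n F : param n F -> param n.+1 (pdif F).
Proof.
move=> [Fn Fl F1 Fr]; split.
- exact: (homog_bar_diff pra_lin pla_lin).
- apply: mlin_bar_diff => //; [exact: pla_lin|..].
  + by move=> p c a b; apply/funext => d; apply: mulr_linl.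
  + by move=> s c a b; apply/funext => d; rewrite /pra mulrDl -scalerAl Fr.
- apply: reduced_bar_diff => //; [exact: pla_lin|..].
  + by move=> p; apply/funext => d; rewrite /pla mul1r.
  + by move=> p; apply/funext => d; rewrite /pra mul1r.
- have tl s : forall F, (forall s, linear (F s)) -> linear (ptail s F).
    elim: s => [|a [|b s] IH] {Fn Fl F1 Fr} F Fr c d e.
    + by rewrite scaler0 addr0.
    + by rewrite bar_tailE /pra mulrDr -scalerAr Fr.
    + rewrite bar_tailE !subfE (IH (fun r => F (a :: r))) // Fr.
      by rewrite opprD addrACA scalerBr.
  case=> [|a s] c d e; first by rewrite scaler0 addr0.
  rewrite /bar_diff !subfE /pla tl // Fr mulrDr -scalerAr opprD addrACA.
  by rewrite -scalerBr.
Qed.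

Lemma param_precomp n F (U : A -> A) : linear U -> param n F -> param n (fun s c => F s (U c)).
Proof.
move=> Ul [Fn Fl F1 Fr]; split.
- by move=> s sn; rewrite Fn.
- by move=> s t c a b; rewrite Fl.
- by move=> s t; rewrite F1.
- by move=> s c a b; rewrite Ul Fr.
Qed.

Lemma param_mulr n F (v : A) : param n F -> param n (fun s c => F s c * v).
Proof.
move=> [Fn Fl F1 Fr]; split.
- by move=> s sn; rewrite Fn //; apply/funext => c; rewrite mul0r.
- by move=> s t c a b; rewrite Fl; apply/funext => d; apply: mulr_linl.
- by move=> s t; rewrite F1; apply/funext => c; rewrite mul0r.
- by move=> s c a b; rewrite Fr mulr_linl.
Qed.

Definition slot f v : seq A -> A -> A := fun s c => f (s ++ c :: v).

Lemma param_slot n p f v : n = (p + (size v).+1)%N -> is_cochain n f -> param p (slot f v).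
Proof.
move=> -> /is_cochainP[fn fl f1]; split.
- move=> s sp; apply/funext => c; rewrite /slot fn // size_cat /= eqn_add2r //.
- move=> s t c a b; apply/funext => d.
  by have := fl s (t ++ d :: v) c a b; rewrite -!cat_cons !catA.
- move=> s t; apply/funext => d.
  by have := f1 s (t ++ d :: v); rewrite -cat_cons catA.
- by move=> s c a b; rewrite /slot fl.
Qed.

Lemma pdif_precomp F (v : A) s c : pdif (fun s c => F s (c * v)) s c = pdif F s (c * v).
Proof.
have tl : forall F, ptail s (fun s c => F s (c * v)) c = ptail s F (c * v).
  elim: s c => [|a [|b s] IH] c {}F //; first by rewrite !bar_tailE /pra mulrA.
  by rewrite !bar_tailE; congr (_ - _); apply: (IH c (fun r => F (a :: r))).
by case: s tl => [//|a s] tl; congr (_ - _); apply: tl.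
Qed.

Lemma pdif_mulr F (v : A) s c : pdif (fun s c => F s c * v) s c = pdif F s c * v.
Proof.
have tl : forall F, ptail s (fun s c => F s c * v) c = ptail s F c * v.
  elim: s c => [|a [|b s] IH] c {}F //; first by rewrite mul0r.
  rewrite !bar_tailE [RHS]mulrBl; congr (_ - _); exact: (IH c (fun r => F (a :: r))).
case: s tl => [|a s] tl; first by rewrite mul0r.
by rewrite [RHS]mulrBl -mulrA; congr (_ - _); apply: tl.
Qed.

Lemma pdif_lin F G (e : k) s :
  pdif (fun s => e *: F s + G s) s = e *: pdif F s + pdif G s.
Proof. exact: (bar_diff_lin pra_lin pla_lin). Qed.

(* The twist by (-1)^(size s) makes the insertion differential commute with the
   Koszul differential acting on the last slot, without further signs. *)
Definition tdif F s : A -> A := (-1) ^+ size s *: pdif F s.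

Lemma tdifE F s c : tdif F s c = (-1) ^+ size s *: pdif F s c.
Proof. by []. Qed.

Lemma pdif_cons F a s c : pdif F (a :: s) c = a * F s c - ptail (a :: s) F c.
Proof. by []. Qed.

Lemma pdif_tdif F s : pdif (tdif F) s = 0.
Proof.
case: s => [//|a s]; rewrite /tdif {1}/bar_diff bar_tail_sign; last exact: pra_lin.
have -> : pla a ((-1) ^+ size s *: pdif F s) = (-1) ^+ size s *: pla a (pdif F s).
  by apply/funext => c; rewrite /pla [in LHS]/GRing.scale /= -scalerAr.
rewrite /= exprS mulN1r scaleNr opprK -scalerBr.
have := bar_diff_bar_diff pra_lin praA pla_lin plaA _ F (a :: s).
by rewrite {1}/bar_diff => ->; rewrite ?scaler0.
Qed.

Lemma htail_cat f v s c : htail (s ++ c :: v) f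
  = ptail s (slot f v) c + (-1) ^+ size s * htail (c :: v) (fun r => f (s ++ r)).
Proof.
elim: s f => [|a s IH] f; first by rewrite expr0 mul1r add0r.
case: s IH => [|b s] IH; rewrite [_ ++ _]/= !bar_tail_cons2.
  by rewrite expr1 mulN1r bar_tailE.
rewrite -cat_cons IH opprD addrA; congr (_ + _).
by rewrite [in RHS]/= exprS mulN1r mulNr.
Qed.

(** The cocycle identity at s, c, v splits at c into the faces on the left and those on the right.
    For empty s the left side is 0, and the right side only meets f in length [size v]; were that
    length n, the identity would have the further term c * f(v). *)
Lemma tdif_slot n f v s c : homog n f -> hdif f = 0 -> size v != n ->
  tdif (slot f v) s c = htail (c :: v) (fun r => f (s ++ r)).
Proof.
move=> fn f0 vn; case: s => [|a s].
  rewrite /tdif scaler0 bar_tail_eq0 //; first exact: mulr_linl.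
  by move=> r rv; rewrite fn // rv.
have := congr1 (fun h => h (a :: s ++ c :: v)) f0.
rewrite [LHS]/bar_diff -cat_cons htail_cat opprD addrA => /eqP; rewrite subr_eq0 => /eqP E.
rewrite tdifE pdif_cons E.
rewrite -!(signr_odd _ (size (a :: s))).
by case: odd; rewrite ?expr0 ?expr1 ?scaleN1r ?mulN1r ?opprK ?scale1r ?mul1r.
Qed.

Lemma ptail_mulr f s c : ptail s (fun r c => f r * c) c = htail s f * c.
Proof.
elim: s f => [|a [|b s] IH] f; first by rewrite mul0r.
  by rewrite !bar_tailE /pra mulrA.
rewrite !bar_tailE subfE (IH (fun r => f (a :: r))) mulrBl //.
Qed.

Lemma pdif_mulc f s c : pdif (fun r c => f r * c) s c = hdif f s * c.
Proof.
case: s => [|a s]; first by rewrite mul0r.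
by rewrite pdif_cons ptail_mulr mulrBl mulrA.
Qed.

Lemma pdifB F G s c : pdif (fun s c => F s c - G s c) s c = pdif F s c - pdif G s c.
Proof.
have := pdif_lin G F (-1) s => /(congr1 (@^~ c)).
have -> : (fun s => -1 *: G s + F s) = (fun s c => F s c - G s c).
  by apply/funext => r; apply/funext => d; rewrite -[LHS]/(-1 *: G r d + F r d) scaleN1r addrC.
by move=> ->; rewrite -[LHS]/(-1 *: pdif G s c + pdif F s c) scaleN1r addrC.
Qed.

Lemma pdifN F s c : pdif (fun s c => - F s c) s c = - pdif F s c.
Proof.
have -> : (fun s c => - F s c) = (fun s c => (F s c - F s c) - F s c).
  by apply/funext => r; apply/funext => d; rewrite subrr sub0r.
by rewrite !pdifB subrr sub0r.
Qed.

Lemma pdifD F G s c : pdif (fun s c => F s c + G s c) s c = pdif F s c + pdif G s c.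
Proof.
rewrite -[X in _ = _ + X]opprK -pdifN -pdifB; congr (pdif _ s c).
by apply/funext => r; apply/funext => d; rewrite opprK.
Qed.

Lemma tdifB F G s c : tdif (fun s c => F s c - G s c) s c = tdif F s c - tdif G s c.
Proof. by rewrite !tdifE pdifB scalerBr. Qed.

Lemma tdifD F G s c : tdif (fun s c => F s c + G s c) s c = tdif F s c + tdif G s c.
Proof. by rewrite !tdifE pdifD scalerDr. Qed.

Lemma tdif0 s c : tdif (fun=> 0) s c = 0 :> A.
Proof.
have -> : (fun=> 0) = (fun s c => (0 : A) - 0) :> (seq A -> A -> A).
  by apply/funext => t; apply/funext => d; rewrite subrr.
by rewrite (tdifB (fun=> 0) (fun=> 0)) subrr.
Qed.

Lemma tdif_precomp F (v : A) s c : tdif (fun s c => F s (c * v)) s c = tdif F s (c * v).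
Proof. by rewrite !tdifE pdif_precomp. Qed.

Lemma tdif_mulr F (v : A) s c : tdif (fun s c => F s c * v) s c = tdif F s c * v.
Proof. by rewrite !tdifE pdif_mulr scalerAl. Qed.

Lemma paramB n F G : param n F -> param n G -> param n (fun s c => F s c - G s c).
Proof.
move=> Fp Gp; have := paramD (-1) Gp Fp; congr param.
by apply/funext => s; apply/funext => c; rewrite -[LHS]/(-1 *: G s c + F s c) scaleN1r addrC.
Qed.

Lemma paramN n F : param n F -> param n (fun s c => - F s c).
Proof.
move=> Fp; have := paramB (param0 n) Fp; congr param.
by apply/funext => s; apply/funext => c; rewrite -[LHS]/(0 - F s c) sub0r.
Qed.

Lemma param_add n F G : param n F -> param n G -> param n (fun s c => F s c + G s c).
Proof.
move=> Fp Gp; have := paramB Fp (paramN Gp); congr param.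
by apply/funext => s; apply/funext => c; rewrite opprK.
Qed.

Lemma param_tdif n F : param n F -> param n.+1 (tdif F).
Proof. by move=> /param_pdif; apply: param_sign. Qed.

Section Cocycle.
Variables (n : nat) (f : seq A -> A).
Hypotheses (fc : is_cochain n f) (f0 : hdif f = 0).

Let fn : homog n f. Proof. by case: fc. Qed.

Let f_0 s t : f (s ++ 0 :: t) = 0.
Proof. by apply: mlin0; case: fc. Qed.

Lemma slot_add (v w : A) s c : slot f [:: v + w] s c = slot f [:: v] s c + slot f [:: w] s c.
Proof.
have [_ fl _] := fc.
by have := fl (s ++ [:: c]) [::] 1 v w; rewrite -!catA !scale1r.
Qed.

Lemma tdif_slot0 s c : 0 != n -> tdif (slot f [::]) s c = f s * c.
Proof. by move=> n0; rewrite (tdif_slot _ _ fn f0) // bar_tailE cats0. Qed.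

Lemma tdif_slot1 (v : A) s c : 1 != n ->
  tdif (slot f [:: v]) s c = slot f [::] s (c * v) - slot f [::] s c * v.
Proof. by move=> n0; rewrite (tdif_slot _ _ fn f0) // !bar_tailE. Qed.

(** On a Koszul tensor all inner products vanish. What survives is the Koszul differential: the
    first letter is multiplied into c and the last one acts on the right. The same holds for three
    and four letters. *)
Lemma tdif_slot2 (v1 v2 : A) s c : v1 * v2 = 0 -> 2 != n ->
  tdif (slot f [:: v1; v2]) s c = slot f [:: v2] s (c * v1) + slot f [:: v1] s c * v2.
Proof.
move=> v12 n0; rewrite (tdif_slot _ _ fn f0) // !bar_tailE v12.
by have := f_0 (s ++ [:: c]) [::]; rewrite -!catA /= => ->; rewrite !sub0r !opprK.
Qed.

Lemma tdif_slot3 (v1 v2 v3 : A) s c : v1 * v2 = 0 -> v2 * v3 = 0 -> 3 != n ->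
  tdif (slot f [:: v1; v2; v3]) s c
  = slot f [:: v2; v3] s (c * v1) - slot f [:: v1; v2] s c * v3.
Proof.
move=> v12 v23 n0; rewrite (tdif_slot _ _ fn f0) // !bar_tailE v12 v23.
have f01 := f_0 (s ++ [:: c]); have f02 := f_0 (s ++ [:: c; v1]).
by move: (f01 [:: v3]) (f02 [::]); rewrite -!catA /= => -> ->; rewrite !sub0r !opprK.
Qed.

Lemma tdif_slot4 (v1 v2 v3 v4 : A) s c : v1 * v2 = 0 -> v2 * v3 = 0 -> v3 * v4 = 0 -> 4 != n ->
  tdif (slot f [:: v1; v2; v3; v4]) s c
  = slot f [:: v2; v3; v4] s (c * v1) + slot f [:: v1; v2; v3] s c * v4.
Proof.
move=> v12 v23 v34 n0; rewrite (tdif_slot _ _ fn f0) // !bar_tailE v12 v23 v34.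
have f01 := f_0 (s ++ [:: c]); have f02 := f_0 (s ++ [:: c; v1]).
have f03 := f_0 (s ++ [:: c; v1; v2]).
by move: (f01 [:: v3; v4]) (f02 [:: v4]) (f03 [::]); rewrite -!catA /= => -> -> ->;
   rewrite !sub0r !opprK.
Qed.
End Cocycle.
End ParamCochains.

(** * Contraction of the Koszul complex by stripping letters *)

Section KoszulContraction.
Variables (k : fieldType) (A : algType k) (x y z : A).
Local Notation u := (x + y).
Local Notation hdif := (@bar_diff k A A *%R *%R).
Local Notation htail := (@bar_tail k A A *%R).
Local Notation pdif := (@bar_diff k A (A -> A) (@pla k A) (@pra k A)).
Hypotheses (ux0 : u * x = 0) (xz0 : x * z = 0) (zy0 : z * y = 0).
Hypothesis A_ind : forall P : A -> Prop,
  (forall c a b, P a -> P b -> P (c *: a + b)) -> P 1 ->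
  (forall a, P a -> P (a * x)) -> (forall a, P a -> P (a * y)) ->
  (forall a, P a -> P (a * z)) -> forall a, P a.
Hypothesis A_map : forall (N : lmodType k) (Rx Ry Rz : N -> N) (n0 : N),
  linear Rx -> linear Ry -> linear Rz ->
  (forall n, Rx (Rx n) + Rx (Ry n) = 0) -> (forall n, Rz (Rx n) = 0) ->
  (forall n, Ry (Rz n) = 0) ->
  {T : A -> N | [/\ linear T, T 1 = n0, forall a, T (a * x) = Rx (T a),
    forall a, T (a * y) = Ry (T a) & forall a, T (a * z) = Rz (T a)]}.

(* In the normal form of words avoiding ux, xz, zx and zuz, [U] and [Z] strip a
   last letter u or z, and [P] is a section of the right multiplication by x. *)
Lemma strip_letters : exists U P Z : A -> A, [/\ linear U, linear P, linear Z &
  forall a, [/\ U (a * u) = a, U (a * z) = 0, Z (a * u) = 0, Z (a * z) = a - P a * x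
    & P (a * x) = a - U a * u]].
Proof.
pose N : lmodType k := (A * A * (A * A))%type.
(* The coordinates of n stand for a, [U a], [P a] and [Z a]. The term [n.2.2 * z] in the coordinate
   of [U] reflects zx = zu, a consequence of zy = 0. [Ry] is the action wanted for u minus [Rx]. *)
pose Rx (n : N) : N := ((n.1.1 * x, n.2.2 * z), (n.1.1 - n.1.2 * u, 0)).
pose Ry (n : N) : N := ((n.1.1 * y, n.1.1 - n.2.2 * z),
  (n.2.2 * z - (n.1.1 - n.1.2 * u), 0)).
pose Rz (n : N) : N := ((n.1.1 * z, 0), (0, n.1.1 - n.2.1 * x)).
have pairP (a b c d a' b' c' d' : A) : a = a' -> b = b' -> c = c' -> d = d' ->
  ((a, b), (c, d)) = ((a', b'), (c', d')) :> N by move=> -> -> -> ->.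
have lin c (a b v : A) : (c *: a + b) * v = c *: (a * v) + b * v by rewrite mulr_linl.
have linB (c : k) (a b a' b' : A) :
    c *: a + b - (c *: a' + b') = c *: (a - a') + (b - b').
  by rewrite opprD addrACA scalerBr.
have [||||||T [Tl T1 Tx Ty Tz]] := @A_map N Rx Ry Rz ((1, 0), (0, 0)).
- by move=> c n m; apply: pairP; rewrite /= ?lin ?linB ?scaler0 ?addr0.
- by move=> c n m; apply: pairP; rewrite /= ?lin ?linB ?scaler0 ?addr0.
- by move=> c n m; apply: pairP; rewrite /= ?lin ?linB ?scaler0 ?addr0.
- move=> n; apply: pairP; rewrite /= ?mul0r ?addr0 //.
    by rewrite -mulrDl -mulrDr -mulrA ux0 mulr0.
  rewrite addrACA -opprD -mulrDl -mulrDr [_ + (_ - _)]addrC subrK; exact: subrr.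
- move=> n; apply: pairP => //=; first by rewrite -mulrA xz0 mulr0.
  by rewrite mulrBl -[X in _ - (_ - X)]mulrA ux0 mulr0 subr0 subrr.
- move=> n; apply: pairP => //=; first by rewrite -mulrA zy0 mulr0.
    by rewrite mulrBl -(mulrA _ x z) xz0 mulr0 subr0 subrr.
  by rewrite mul0r subr0 mulrBl -(mulrA _ x z) xz0 mulr0 subr0 subrr.
have Ta : forall a, (T a).1.1 = a.
  apply: A_ind => [c a b Ha Hb||a Ha|a Ha|a Ha]; rewrite ?Tl ?T1 ?Tx ?Ty ?Tz //=.
  + by rewrite Ha Hb.
  + by rewrite Ha. + by rewrite Ha. + by rewrite Ha.
have Tu a : T (a * u) = Rx (T a) + Ry (T a).
  by rewrite mulrDr -[a * x]scale1r Tl scale1r Tx Ty.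
exists (fun a => (T a).1.2), (fun a => (T a).2.1), (fun a => (T a).2.2); split.
- by move=> c a b; rewrite Tl.
- by move=> c a b; rewrite Tl.
- by move=> c a b; rewrite Tl.
- move=> a; rewrite Tu Tx Tz /= Ta; split=> //.
  + by rewrite addrC subrK.
  + by rewrite addr0.
Qed.

(** Exactness at V_1 expresses that A is presented by its relations. Let a letter v act on A x A by
    (a, b) |-> (a v, r_v(a) + b v): the three equations say that this action respects the relations,
    and K is the second coordinate of the map that sends 1 to (1, 0). *)
Lemma solve_koszul1 p (rx ry rz : seq A -> A -> A) :
  param p rx -> param p ry -> param p rz ->
  (forall s c, rx s (c * u) + (rx s c + ry s c) * x = 0) ->
  (forall s c, rz s (c * x) + rx s c * z = 0) ->
  (forall s c, ry s (c * z) + rz s c * y = 0) ->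
  exists2 K, param p K & forall s c, [/\ K s (c * x) = rx s c + K s c * x,
    K s (c * y) = ry s c + K s c * y & K s (c * z) = rz s c + K s c * z].
Proof.
move=> [xn xl x1 xr] [yn yl y1 yr] [zn zl z1 zr] rux rxz rzy.
pose N : lmodType k := (A * A)%type.
pose R v (r : A -> A) (n : N) : N := (n.1 * v, r n.1 + n.2 * v).
have Rl v r : linear r -> linear (R v r).
  move=> rl c n m; congr pair; rewrite /= ?mulr_linl // rl.
  by rewrite addrACA scalerDr.
have rD (r : A -> A) a b : linear r -> r (a + b) = r a + r b.
  by move=> rl; have := rl 1 a b; rewrite !scale1r.
have [T TP] : {T : seq A -> A -> N | forall s, [/\ linear (T s), T s 1 = (1, 0),
    forall a, T s (a * x) = R x (rx s) (T s a),
    forall a, T s (a * y) = R y (ry s) (T s a)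
  & forall a, T s (a * z) = R z (rz s) (T s a)]}.
  suff TP s : {T : A -> N | [/\ linear T, T 1 = (1, 0), forall a, T (a * x) = R x (rx s) (T a),
    forall a, T (a * y) = R y (ry s) (T a) & forall a, T (a * z) = R z (rz s) (T a)]}.
    by exists (fun s => sval (TP s)) => s; apply: (svalP (TP s)).
  apply: A_map; rewrite /R; try exact: Rl.
  - move=> n; congr pair => /=.
      by rewrite -mulrDl -mulrDr -mulrA ux0 mulr0.
    rewrite addrACA -rD // -mulrDr -[RHS](rux s n.1) -mulrDl; congr (_ + _).
    rewrite addrACA -mulrDr mulrDl -[X in _ + X]mulrA ux0 mulr0 addr0.
    by rewrite mulrDl.
  - move=> n; congr pair => /=; first by rewrite -mulrA xz0 mulr0.
    by rewrite mulrDl -(mulrA _ x z) xz0 mulr0 addr0.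
  - move=> n; congr pair => /=; first by rewrite -mulrA zy0 mulr0.
    by rewrite mulrDl -(mulrA _ z y) zy0 mulr0 addr0.
have T1 s : forall a, (T s a).1 = a.
  have [Tl T1 Tx Ty Tz] := TP s.
  apply: A_ind => [c a b Ha Hb||a Ha|a Ha|a Ha]; rewrite ?Tl ?T1 ?Tx ?Ty ?Tz //=.
  + by rewrite Ha Hb.
  + by rewrite Ha. + by rewrite Ha. + by rewrite Ha.
pose K s a := (T s a).2.
have KP s c : [/\ K s (c * x) = rx s c + K s c * x,
    K s (c * y) = ry s c + K s c * y & K s (c * z) = rz s c + K s c * z].
  by have [_ _ Tx Ty Tz] := TP s; rewrite /K Tx Ty Tz /= T1.
have K1 s : K s 1 = 0 by rewrite /K; have [_ -> _ _ _] := TP s.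
have Kl s : linear (K s) by rewrite /K => c a b; have [-> _ _ _ _] := TP s.
(* K is built separately for each s, but it is determined by [K s 1 = 0] and the recursion in [KP];
   induction on c therefore transfers the properties in s from the right-hand sides to K. *)
exists K => //; split=> //.
- move=> s sp; apply/funext; apply: A_ind => [c a b Ha Hb||a Ha|a Ha|a Ha].
  + by rewrite Kl Ha Hb scaler0 addr0.
  + exact: K1.
  + by have [-> _ _] := KP s a; rewrite xn // Ha mul0r addr0.
  + by have [_ -> _] := KP s a; rewrite yn // Ha mul0r addr0.
  + by have [_ _ ->] := KP s a; rewrite zn // Ha mul0r addr0.
- move=> s t e v w; apply/funext.
  have E (p1 p2 : A -> A) d : (e *: p1 + p2) d = e *: p1 d + p2 d by [].
  have step a b c d f g (v' : A) : f = e *: c + d -> g = e *: a + b ->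
      g + f * v' = e *: (a + c * v') + (b + d * v').
    by move=> -> ->; rewrite mulr_linl scalerDr addrACA.
  apply: A_ind => [c a b Ha Hb||a Ha|a Ha|a Ha]; rewrite !E.
  + rewrite !Kl Ha Hb !E !scalerDr !scalerA [c * e]mulrC.
    by rewrite addrACA.
  + by rewrite !K1 scaler0 addr0.
  + have [-> _ _] := KP (s ++ (e *: v + w) :: t) a; have [-> _ _] := KP (s ++ v :: t) a.
    by have [-> _ _] := KP (s ++ w :: t) a; apply: step; rewrite ?xl.
  + have [_ -> _] := KP (s ++ (e *: v + w) :: t) a; have [_ -> _] := KP (s ++ v :: t) a.
    by have [_ -> _] := KP (s ++ w :: t) a; apply: step; rewrite ?yl.
  + have [_ _ ->] := KP (s ++ (e *: v + w) :: t) a; have [_ _ ->] := KP (s ++ v :: t) a.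
    by have [_ _ ->] := KP (s ++ w :: t) a; apply: step; rewrite ?zl.
- move=> s t; apply/funext; apply: A_ind => [c a b Ha Hb||a Ha|a Ha|a Ha].
  + by rewrite Kl Ha Hb scaler0 addr0.
  + exact: K1.
  + by have [-> _ _] := KP (s ++ 1 :: t) a; rewrite x1 // Ha mul0r addr0.
  + by have [_ -> _] := KP (s ++ 1 :: t) a; rewrite y1 // Ha mul0r addr0.
  + by have [_ _ ->] := KP (s ++ 1 :: t) a; rewrite z1 // Ha mul0r addr0.
Qed.

Let sub_exchange (a b c d : A) : a - b = c - d -> a - c = b - d.
Proof.
by move=> /eqP; rewrite subr_eq => /eqP ->; rewrite -addrA addrC addrA subrK.
Qed.

(** * Descent from the top Koszul degree to a Hochschild primitive *)

Section Descent.
Variables (f : seq A -> A).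

(** At the bottom r is right A-linear in c, hence r(s, c) = r(s, 1) c. Since r and [slot f [::]]
    have the same differential, and [tdif_slot0] recovers f at c = 1, the cochain r(s, 1) is a
    primitive up to sign. *)
Lemma descent0 p (r : seq A -> A -> A) : is_cochain p.+1 f -> hdif f = 0 -> param p r ->
  (forall s c, pdif r s c = pdif (slot f [::]) s c) ->
  (forall s c, r s (c * x) = r s c * x) -> (forall s c, r s (c * y) = r s c * y) ->
  (forall s c, r s (c * z) = r s c * z) ->
  exists2 h, is_cochain p h & f = hdiff p h.
Proof.
move=> fc f0 [rn rl r1 rr] rf rx ry rz.
have rE s : forall c, r s c = r s 1 * c.
  apply: A_ind => [c a b Ha Hb||a Ha|a Ha|a Ha].
  - by rewrite rr Ha Hb mulr_linr.
  - by rewrite mulr1.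
  - by rewrite rx Ha mulrA.
  - by rewrite ry Ha mulrA.
  - by rewrite rz Ha mulrA.
pose h0 s := (r s : A -> A) 1.
have h0c : is_cochain p h0.
  apply/is_cochainP; split=> [s sp|s t c a b|s t]; rewrite /h0.
  - by rewrite rn.
  - by rewrite rl.
  - by rewrite r1.
(* The sign is the twist of [tdif] at length [p.+1]. *)
exists ((-1) ^+ p.+1 *: h0).
  have := cochain_lin ((-1) ^+ p.+1) h0c (cochain0 _ p); congr is_cochain.
  by rewrite addr0.
have /is_cochainP[h0n _ _] := h0c.
have -> : (-1) ^+ p.+1 *: h0 = (-1) ^+ p.+1 *: h0 + 0 by rewrite addr0.
rewrite hdiff_lin hdiff0 addr0 (hdiffE h0n).
apply/funext => s; rewrite -[RHS]/((-1) ^+ p.+1 *: hdif h0 s).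
have [sp|sp] := eqVneq (size s) p.+1; last first.
  by rewrite (homog_hdif h0n sp) scaler0; case: fc => ->.
rewrite -sp -[LHS]mulr1 -(tdif_slot0 fc f0) // tdifE -rf.
have -> : r = fun s c => h0 s * c by apply/funext => t; apply/funext => c; apply: rE.
by rewrite pdif_mulc mulr1.
Qed.

(** The pattern of every descent step: the given family is a Koszul cocycle, hence the Koszul
    differential of some K. One level down, [slot f] corrected by [tdif K] is again a Koszul
    cocycle, because [tdif] of the given family and of [slot f] agree; and [pdif] kills [tdif K], so
    the corrected family still has the differential of [slot f]. *)
Lemma descent1 p (rx ry rz : seq A -> A -> A) : is_cochain p.+2 f -> hdif f = 0 ->
  param p rx -> param p ry -> param p rz ->
  (forall s c, pdif rx s c = pdif (slot f [:: x]) s c) ->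
  (forall s c, pdif ry s c = pdif (slot f [:: y]) s c) ->
  (forall s c, pdif rz s c = pdif (slot f [:: z]) s c) ->
  (forall s c, rx s (c * u) + (rx s c + ry s c) * x = 0) ->
  (forall s c, rz s (c * x) + rx s c * z = 0) ->
  (forall s c, ry s (c * z) + rz s c * y = 0) ->
  exists2 h, is_cochain p.+1 h & f = hdiff p.+1 h.
Proof.
move=> fc f0 xp yp zp xf yf zf rux rxz rzy.
have [K Kp KE] := solve_koszul1 xp yp zp rux rxz rzy.
pose r0 s c := slot f [::] s c - tdif K s c.
have step v rv : (forall s c, rv s c = K s (c * v) - K s c * v) ->
    (forall s c, pdif rv s c = pdif (slot f [:: v]) s c) ->
    forall s c, r0 s (c * v) = r0 s c * v.
  move=> rvE rvf s c; rewrite /r0 mulrBl; apply: sub_exchange.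
  rewrite -tdif_precomp -tdif_mulr -tdifB -(tdif_slot1 fc f0) //.
  rewrite tdifE -rvf -tdifE; congr (tdif _ s c).
  by apply/funext => t; apply/funext => d.
apply: (@descent0 _ r0) => //.
- by apply: paramB; [apply: param_slot fc; rewrite addn1|apply: param_tdif].
- by move=> s c; rewrite /r0 pdifB pdif_tdif subr0.
- by apply: step xf => s c; have [-> _ _] := KE s c; rewrite addrK.
- by apply: step yf => s c; have [_ -> _] := KE s c; rewrite addrK.
- by apply: step zf => s c; have [_ _ ->] := KE s c; rewrite addrK.
Qed.

Lemma descent2 p (rux rxz rzy : seq A -> A -> A) : is_cochain p.+3 f -> hdif f = 0 ->
  param p rux -> param p rxz -> param p rzy ->
  (forall s c, pdif rux s c = pdif (slot f [:: u; x]) s c) ->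
  (forall s c, pdif rxz s c = pdif (slot f [:: x; z]) s c) ->
  (forall s c, pdif rzy s c = pdif (slot f [:: z; y]) s c) ->
  (forall s c, rxz s (c * u) = rux s c * z) ->
  (forall s c, rzy s (c * x) = rxz s c * y) ->
  exists2 h, is_cochain p.+2 h & f = hdiff p.+2 h.
Proof.
move=> fc f0 uxp xzp zyp uxf xzf zyf ruxz rxzy.
have [U [P [Z [Ul Pl Zl E]]]] := strip_letters.
have Ux a : U (a * u) = a by case: (E a).
have Uz a : U (a * z) = 0 by case: (E a).
have Zu a : Z (a * u) = 0 by case: (E a).
have Zz a : Z (a * z) = a - P a * x by case: (E a).
have Px a : P (a * x) = a - U a * u by case: (E a).
(* The value on y is taken to be -[Kx]. The Koszul differential on u, x is Kx(cu) + (Kx + Ky)(c) x,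
   and with this choice it reduces to Kx(cu). *)
pose Kx s c := rux s (U c) - rzy s (Z c).
pose Kz s c := rxz s (P c) - Kx s (P c) * z.
have Kxp : param p Kx by apply: paramB; apply: param_precomp.
have Kzp : param p Kz.
  by apply: paramB; [|apply: param_mulr]; apply: param_precomp.
have lin0 r s : @param k A p r -> r s 0 = 0.
  case=> _ _ _ rl; have := rl s (-1) 0 0.
  by rewrite scaler0 addr0 scaleN1r addNr.
have linB r s a b : @param k A p r -> r s (a - b) = r s a - r s b.
  case=> _ _ _ rl; have := rl s (-1) b a.
  by rewrite !scaleN1r [- b + a]addrC [- _ + r s a]addrC.
have Eux s c : rux s c = Kx s (c * u) by rewrite /Kx Ux Zu (lin0 rzy) // subr0.
have Exz s c : rxz s c = Kz s (c * x) + Kx s c * z.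
  rewrite /Kz Px !linB // mulrBl ruxz -Eux opprB.
  by rewrite addrA subrK subrK.
have Ezy s c : rzy s c = - Kx s (c * z) + Kz s c * y.
  rewrite {1}/Kx Uz (lin0 rux) // sub0r opprK Zz linB // rxzy /Kz mulrBl.
  by rewrite -[_ * z * y]mulrA zy0 mulr0 subr0 subrK.
pose rx s c := slot f [:: x] s c - tdif Kx s c.
pose ry s c := slot f [:: y] s c + tdif Kx s c.
pose rz s c := slot f [:: z] s c - tdif Kz s c.
have slotp v : param p.+1 (slot f [:: v]) by apply: param_slot fc; rewrite addn2.
apply: (@descent1 _ rx ry rz) => //.
- by apply: paramB; [|apply: param_tdif].
- by apply: param_add; [|apply: param_tdif].
- by apply: paramB; [|apply: param_tdif].
- by move=> s c; rewrite pdifB pdif_tdif subr0.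
- by move=> s c; rewrite pdifD pdif_tdif addr0.
- by move=> s c; rewrite pdifB pdif_tdif subr0.
- move=> s c; rewrite /rx /ry addrACA addNr addr0 -(slot_add fc) addrAC.
  rewrite -(tdif_slot2 fc f0) // tdifE -uxf -tdifE.
  rewrite -tdif_precomp -tdifB (_ : (fun s c => _) = fun=> 0) ?tdif0 //.
  by apply/funext => t; apply/funext => d; rewrite -Eux subrr.
- move=> s c; rewrite /rx /rz mulrBl addrACA -opprD -(tdif_slot2 fc f0) //.
  rewrite tdifE -xzf -tdifE -tdif_precomp -tdif_mulr -tdifD -tdifB.
  rewrite (_ : (fun s c => _) = fun=> 0) ?tdif0 //.
  by apply/funext => t; apply/funext => d; rewrite -Exz subrr.
- move=> s c; rewrite /ry /rz mulrBl addrACA -(tdif_slot2 fc f0) //.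
  rewrite tdifE -zyf -tdifE -tdif_precomp -tdif_mulr -tdifB -tdifD.
  rewrite (_ : (fun s c => _) = fun=> 0) ?tdif0 //.
  apply/funext => t; apply/funext => d; rewrite Ezy addrACA addNr add0r.
  exact: subrr.
Qed.

Lemma descent3 p (ruxz rxzy : seq A -> A -> A) : is_cochain p.+4 f -> hdif f = 0 ->
  param p ruxz -> param p rxzy ->
  (forall s c, pdif ruxz s c = pdif (slot f [:: u; x; z]) s c) ->
  (forall s c, pdif rxzy s c = pdif (slot f [:: x; z; y]) s c) ->
  (forall s c, rxzy s (c * u) + ruxz s c * y = 0) ->
  exists2 h, is_cochain p.+3 h & f = hdiff p.+3 h.
Proof.
move=> fc f0 uxzp xzyp uxzf xzyf ruxzy.
have [U [P [Z [Ul Pl _ E]]]] := strip_letters.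
have Ux a : U (a * u) = a by case: (E a).
have Px a : P (a * x) = a - U a * u by case: (E a).
(* The component on u, x is taken to be 0, so [slot f [:: u; x]] is passed on uncorrected. *)
pose Kxz s c := ruxz s (U c).
pose Kzy s c := rxzy s (P c).
have Kxzp : param p Kxz by apply: param_precomp.
have Kzyp : param p Kzy by apply: param_precomp.
have Exzy s c : rxzy s c = Kzy s (c * x) - Kxz s c * y.
  have [_ _ _ /(_ s)rl] := xzyp.
  have -> : Kzy s (c * x) = rxzy s c - rxzy s (U c * u).
    have := rl (-1) (U c * u) c.
    by rewrite /Kzy Px !scaleN1r [- _ + c]addrC [- _ + rxzy s c]addrC.
  by have /eqP := ruxzy s (U c); rewrite addr_eq0 => /eqP ->; rewrite opprK addrK.
have slotp v w : param p.+1 (slot f [:: v; w]) by apply: param_slot fc; rewrite addn3.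
apply: (@descent2 _ (slot f [:: u; x]) (fun s c => slot f [:: x; z] s c - tdif Kxz s c)
  (fun s c => slot f [:: z; y] s c - tdif Kzy s c)) => //.
- by apply: paramB; [|apply: param_tdif].
- by apply: paramB; [|apply: param_tdif].
- by move=> s c; rewrite pdifB pdif_tdif subr0.
- by move=> s c; rewrite pdifB pdif_tdif subr0.
- move=> s c; apply/eqP; rewrite -subr_eq0 addrAC -(tdif_slot3 fc f0) //.
  rewrite tdifE -uxzf -tdifE -tdif_precomp -tdifB.
  rewrite (_ : (fun s c => _) = fun=> 0) ?tdif0 //.
  by apply/funext => t; apply/funext => d; rewrite /Kxz Ux subrr.
- move=> s c; rewrite mulrBl; apply: sub_exchange.
  rewrite -(tdif_slot3 fc f0) // tdifE -xzyf -tdifE -tdif_precomp -tdif_mulr -tdifB.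
  by congr (tdif _ s c); apply/funext => t; apply/funext => d.
Qed.

(** As V_5 = 0, the slot at u, x, z, y has no equation to satisfy, and composing it with [U] lifts
    it since [U (c * u) = c]. This covers all degrees from 5 on. *)
Lemma descent4 p : is_cochain p.+4.+1 f -> hdif f = 0 ->
  exists2 h, is_cochain p.+4 h & f = hdiff p.+4 h.
Proof.
move=> fc f0; have [U [P [Z [Ul _ _ E]]]] := strip_letters.
have Ux a : U (a * u) = a by case: (E a).
pose r := slot f [:: u; x; z; y].
have rp : param p r by apply: param_slot fc; rewrite /= !addnS addn0.
have slotp v w t : param p.+1 (slot f [:: v; w; t]).
  by apply: param_slot fc; rewrite /= !addnS addn0.
have Kp : param p (fun s c => r s (U c)) by apply: param_precomp.
apply: (@descent3 _ (slot f [:: u; x; z])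
  (fun s c => slot f [:: x; z; y] s c - tdif (fun s c => r s (U c)) s c)) => //.
- by apply: paramB; [|apply: param_tdif].
- by move=> s c; rewrite pdifB pdif_tdif subr0.
- move=> s c; rewrite addrAC -(tdif_slot4 fc f0) // -tdif_precomp -tdifB.
  rewrite (_ : (fun s c => _) = fun=> 0) ?tdif0 //.
  by apply/funext => t; apply/funext => d; rewrite Ux subrr.
Qed.

Lemma cocycle1_coboundary : is_cochain 1 f -> hdif f = 0 ->
  f [:: x] = 0 -> f [:: y] = 0 -> f [:: z] = 0 ->
  exists2 h, is_cochain 0 h & f = hdiff 0 h.
Proof.
move=> fc f0 fx fy fz; have step v s c : f [:: v] = 0 ->
    slot f [::] s (c * v) = slot f [::] s c * v.
  move=> fv; case: s => [|a s].
    have := congr1 (fun h => h [:: c; v]) f0; rewrite /bar_diff !bar_tailE fv mulr0 sub0r opprB.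
    by move/eqP; rewrite subr_eq0 => /eqP.
  by have [fn _ _] := fc; rewrite /slot !fn ?mul0r //= size_cat addnS.
apply: (@descent0 _ (slot f [::])) => //; first exact: param_slot fc.
- by move=> s c; apply: step.
- by move=> s c; apply: step.
- by move=> s c; apply: step.
Qed.

(** This is the case excluded from [tdif_slot4]: the cocycle identity at c, u, x, z, y has the extra
    term c * f(u, x, z, y), which vanishes by assumption. The descent can then start at V_3 with the
    slots of f themselves. *)
Lemma cocycle4_coboundary : is_cochain 4 f -> hdif f = 0 -> f [:: u; x; z; y] = 0 ->
  exists2 h, is_cochain 3 h & f = hdiff 3 h.
Proof.
move=> fc f0 fuxzy; have [fn _ _] := fc.
have f_0 s t : f (s ++ 0 :: t) = 0 by apply: mlin0; case: fc.
apply: (@descent3 _ (slot f [:: u; x; z]) (slot f [:: x; z; y])) => //.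
- exact: param_slot fc.
- exact: param_slot fc.
- move=> [|a s] c; last first.
    by rewrite /slot !fn ?mul0r ?addr0 //= size_cat !addnS.
  have := congr1 (fun h => h [:: c; u; x; z; y]) f0.
  rewrite /bar_diff !bar_tailE ux0 xz0 zy0 fuxzy mulr0.
  have f01 := f_0 [:: c]; have f02 := f_0 [:: c; u]; have f03 := f_0 [:: c; u; x].
  move: (f01 [:: z; y]) (f02 [:: y]) (f03 [::]); rewrite /= => -> -> ->.
  by rewrite !sub0r !opprK opprD -opprD => /eqP; rewrite oppr_eq0 => /eqP.
Qed.

End Descent.

(** * Cup products, algebra maps and twisted derivations *)

Fixpoint prod_cochain (fs : seq (A -> A)) (s : seq A) : A :=
  match fs, s with
  | [::], [::] => 1
  | g :: fs', a :: s' => g a * prod_cochain fs' s'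
  | _, _ => 0
  end.

Lemma prod_cochainP (fs : seq (A -> A)) :
  (forall i, linear (nth id fs i)) -> (forall i, (i < size fs)%N -> nth id fs i 1 = 0) ->
  is_cochain (size fs) (prod_cochain fs).
Proof.
move=> fl f1; split.
- elim: fs {fl f1} => [|g fs IH] [|a s] //= sn.
  by rewrite IH ?mulr0.
- move=> s; elim: s fs fl {f1} => [|d s IH] [|g fs] fl t c a b //=.
  + by rewrite scaler0 addr0.
  + by have gl : linear g := fl 0; rewrite gl mulr_linl.
  + by rewrite scaler0 addr0.
  + by rewrite (IH fs (fun i => fl i.+1)) mulr_linr.
- move=> s; elim: s fs f1 {fl} => [|d s IH] [|g fs] f1 t //=.
  + by have g1 : g 1 = 0 := f1 0 isT; rewrite g1 mul0r.
  + by rewrite IH ?mulr0 // => i; apply: (f1 i.+1).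
Qed.

Definition alg_hom (B : algType k) (h : A -> B) : Prop :=
  [/\ linear h, h 1 = 1 & forall a b, h (a * b) = h a * h b].

Lemma alg_hom_id : alg_hom (id : A -> A).
Proof. by split. Qed.

Lemma alg_hom_exists (B : algType k) (bx by_ bz : B) :
  (bx + by_) * bx = 0 -> bx * bz = 0 -> bz * by_ = 0 ->
  exists2 h : A -> B, alg_hom h & [/\ h x = bx, h y = by_ & h z = bz].
Proof.
move=> rux rxz rzy.
have [||||||h [hl h1 hx hy hz]] := @A_map B ( *%R^~ bx) ( *%R^~ by_) ( *%R^~ bz) 1.
- exact: mulr_linl.
- exact: mulr_linl.
- exact: mulr_linl.
- by move=> n; rewrite -mulrDl -mulrDr -mulrA rux mulr0.
- by move=> n; rewrite -mulrA rxz mulr0.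
- by move=> n; rewrite -mulrA rzy mulr0.
exists h; last by rewrite -{1}[x]mul1r -{1}[y]mul1r -{1}[z]mul1r hx hy hz h1 !mul1r.
have hv v hv : (forall a, h (a * v) = h a * hv) -> h v = hv.
  by move=> /(_ 1); rewrite mul1r h1 mul1r.
split=> // a; apply: A_ind => [c b d Hb Hd||b Hb|b Hb|b Hb].
- by rewrite mulrDr -scalerAr !hl Hb Hd mulrDr -scalerAr.
- by rewrite h1 !mulr1.
- by rewrite mulrA !hx Hb mulrA.
- by rewrite mulrA !hy Hb mulrA.
- by rewrite mulrA !hz Hb mulrA.
Qed.

(** A 1-cocycle with coefficients in B, where A acts on the left through [al] and on the right
    through [be]. *)
Definition twisted_der (B : algType k) (al be : A -> B) (D : A -> B) : Prop :=
  linear D /\ forall a b, D (a * b) = al a * D b + D a * be b.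

(** D is a twisted derivation when the upper triangular matrices with rows (al, D) and (0, be)
    multiply. The module B x B is their first row, and the three equations make the relations of A
    act on it by 0. *)
Lemma twisted_der_exists (B : algType k) (al be : A -> B) (dx dy dz : B) :
  alg_hom al -> alg_hom be ->
  al u * dx + (dx + dy) * be x = 0 -> al x * dz + dx * be z = 0 ->
  al z * dy + dz * be y = 0 ->
  exists2 D : A -> B, twisted_der al be D & [/\ D x = dx, D y = dy & D z = dz].
Proof.
move=> [all al1 alM] [bel be1 beM] rux rxz rzy.
have h0 (h : A -> B) : linear h -> h 0 = 0.
  by move=> hl; have := hl (-1) 0 0; rewrite scaler0 addr0 scaleN1r addNr.
have hD (h : A -> B) a b : linear h -> h (a + b) = h a + h b.
  by move=> hl; have := hl 1 a b; rewrite !scale1r.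
pose N : lmodType k := (B * B)%type.
pose R v (dv : B) (n : N) : N := (n.1 * al v, n.1 * dv + n.2 * be v).
have Rl v dv : linear (R v dv).
  by move=> c n m; congr pair; rewrite /= !mulr_linl // scalerDr addrACA.
have [||||||T [Tl T1 Tx Ty Tz]] := @A_map N (R x dx) (R y dy) (R z dz) (1, 0).
- exact: Rl.
- exact: Rl.
- exact: Rl.
- move=> n; congr pair => /=.
    by rewrite -!mulrA -!alM -mulrDr -hD // -mulrDl ux0 h0 // mulr0.
  transitivity (n.1 * (al u * dx + (dx + dy) * be x) + n.2 * be (u * x)).
    rewrite beM !hD // !mulrDl !mulrDr !mulrA !addrA.
    by rewrite [LHS](ACl (1*4*2*5*3*6)).
  by rewrite rux ux0 h0 // !mulr0 addr0.
- move=> n; congr pair => /=; first by rewrite -mulrA -alM xz0 h0 // mulr0.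
  by rewrite mulrDl -!mulrA -beM xz0 (h0 be) // mulr0 addr0 -mulrDr rxz mulr0.
- move=> n; congr pair => /=; first by rewrite -mulrA -alM zy0 h0 // mulr0.
  by rewrite mulrDl -!mulrA -beM zy0 (h0 be) // mulr0 addr0 -mulrDr rzy mulr0.
have Tal : forall a, (T a).1 = al a.
  apply: A_ind => [c a b Ha Hb||a Ha|a Ha|a Ha]; rewrite ?Tl ?T1 ?Tx ?Ty ?Tz /=.
  - by rewrite Ha Hb all.
  - by rewrite al1.
  - by rewrite Ha alM.
  - by rewrite Ha alM.
  - by rewrite Ha alM.
exists (fun a => (T a).2); last first.
  rewrite -{1}[x]mul1r -{1}[y]mul1r -{1}[z]mul1r Tx Ty Tz T1 /=.
  by rewrite !mul1r !mul0r !addr0.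
split=> [c a b|a]; first by rewrite Tl.
have step v dv b : (T (a * b)).2 = al a * (T b).2 + (T a).2 * be b ->
    al (a * b) * dv + (T (a * b)).2 * be v
    = al a * (al b * dv + (T b).2 * be v) + (T a).2 * be (b * v).
  by move=> ->; rewrite alM beM mulrDl mulrDr !mulrA addrA.
apply: A_ind => [c b d Hb Hd||b Hb|b Hb|b Hb].
- rewrite mulrDr -scalerAr !Tl /= Hb Hd bel !mulrDr -!scalerAr.
  by rewrite scalerDr addrACA.
- by rewrite mulr1 T1 mulr0 add0r be1 mulr1.
- by rewrite mulrA !Tx /= !Tal; apply: step.
- by rewrite mulrA !Ty /= !Tal; apply: step.
- by rewrite mulrA !Tz /= !Tal; apply: step.
Qed.

Implicit Types (f g h : seq A -> A).

Lemma twisted_der1 (B : algType k) (al be : A -> B) D :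
  alg_hom al -> alg_hom be -> twisted_der al be D -> D 1 = 0.
Proof.
move=> [_ al1 _] [_ be1 _] [_ DM].
by apply: (addrI (D 1)); rewrite addr0 -{3}[1]mulr1 DM al1 be1 mul1r mulr1.
Qed.

Lemma prod_cochain_hcocycle (fs : seq (A -> A)) :
  (forall i, linear (nth id fs i)) -> (forall i, (i < size fs)%N -> nth id fs i 1 = 0) ->
  (forall s, size s = (size fs).+1 -> hdif (prod_cochain fs) s = 0) ->
  prod_cochain fs \in hcocycle (size fs).
Proof.
move=> fl f1 fd; have fc := prod_cochainP fl f1; apply/hcocycleP; split=> //.
have [fn _ _] := fc; rewrite hdiffE //; apply/funext => s.
have [/fd -> //|sn] := eqVneq (size s) (size fs).+1.
by rewrite (homog_hdif fn sn).
Qed.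

Lemma derivation_hcocycle D : twisted_der id id D -> prod_cochain [:: D] \in hcocycle 1.
Proof.
move=> DD; have [Dl DM] := DD; have D1 := twisted_der1 alg_hom_id alg_hom_id DD.
apply: (@prod_cochain_hcocycle [:: D]) => [[|[|i]]|[|i]|] //.
move=> [|a [|b [|c s]]] // _.
rewrite hdif_cons !bar_tailE /= !mulr1 DM opprB !opprD !addrA.
by rewrite [LHS](ACl ((1*3)*(2*4))) /= !subrr addr0.
Qed.

Section Augmentation.
Variable eps : A -> A.
Hypothesis eps_hom : alg_hom eps.

(** The right twist of each factor is the left twist of the next one, so the terms from the product
    rules cancel between neighbouring faces. The outer twists are the identity, which cancels the
    two outer faces. *)
Lemma prod4_hcocycle la mu nu rho :
  twisted_der id eps la -> twisted_der eps eps mu -> twisted_der eps eps nu ->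
  twisted_der eps id rho -> prod_cochain [:: la; mu; nu; rho] \in hcocycle 4.
Proof.
move=> laD muD nuD rhoD; have [lal laM] := laD; have [mul muM] := muD.
have [nul nuM] := nuD; have [rhol rhoM] := rhoD.
have la1 := twisted_der1 alg_hom_id eps_hom laD.
have mu1 := twisted_der1 eps_hom eps_hom muD.
have nu1 := twisted_der1 eps_hom eps_hom nuD.
have rho1 := twisted_der1 eps_hom alg_hom_id rhoD.
apply: (@prod_cochain_hcocycle [:: la; mu; nu; rho]) => [[|[|[|[|[|i]]]]]|[|[|[|[|i]]]]|] //.
move=> [|a [|b [|c [|d [|e [|? s]]]]]] // _.
rewrite hdif_cons !bar_tailE /= !mulr1 laM muM nuM rhoM.
rewrite !mulrDl !mulrDr !mulrA !opprD !opprK !addrA.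
by rewrite subrr sub0r addNr add0r subrr sub0r addNr add0r subrr.
Qed.
End Augmentation.

(** * Coboundary criteria and the explicit cocycles *)

Lemma hcocycle1_coboundary f : f \in hcocycle 1 ->
  f [:: x] = 0 -> f [:: y] = 0 -> f [:: z] = 0 -> f \in hcoboundary 1.
Proof.
move=> /hcocycleP[fc f0] fx fy fz; apply/hcoboundaryP.
by apply: cocycle1_coboundary => //; case: (fc) => fn _ _; rewrite -(hdiffE fn).
Qed.

Lemma hcocycle7_coboundary f : f \in hcocycle 7 -> f \in hcoboundary 7.
Proof.
move=> /hcocycleP[fc f0]; apply/hcoboundaryP.
by apply: (@descent4 f 2) => //; case: (fc) => fn _ _; rewrite -(hdiffE fn).
Qed.

Lemma hdiff3_koszul h : is_cochain 3 h ->
  hdiff 3 h [:: u; x; z; y] = u * h [:: x; z; y] + h [:: u; x; z] * y.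
Proof.
move=> hc; have [hn hl _] := hc; rewrite (hdiffE hn) hdif_cons !bar_tailE ux0 xz0 zy0.
rewrite (mlin0 [::] [:: z; y] hl) (mlin0 [:: u] [:: y] hl) (mlin0 [:: u; x] [::] hl).
by rewrite !sub0r !opprK.
Qed.

Lemma augmentation_exists :
  exists2 eps : A -> A, alg_hom eps & [/\ eps x = 0, eps y = 0 & eps z = 0].
Proof. by apply: alg_hom_exists; rewrite ?mulr0. Qed.

(** A Koszul coboundary in degree 4 has the form u phi(xzy) + phi(uxz) y, so values in Ay can be
    removed. The correcting cochain [psi] is a cup product with phi(xzy) = 0 and phi(uxz) = w; its
    factors exist because the relations impose nothing on values when both twists are the
    augmentation. *)
Lemma hcocycle4_coboundary f w : f \in hcocycle 4 ->
  f [:: u; x; z; y] = w * y -> f \in hcoboundary 4.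
Proof.
move=> fc fw; have [eps epsH [epsx epsy epsz]] := augmentation_exists.
have D_ex dx dy dz : exists2 D : A -> A, twisted_der eps eps D &
    [/\ D x = dx, D y = dy & D z = dz].
  apply: twisted_der_exists => //; rewrite ?epsx ?epsy ?epsz ?mul0r ?mulr0 ?addr0 //.
  have [el _ _] := epsH; have := el 1 x y; rewrite !scale1r epsx epsy addr0 => ->.
  by rewrite mul0r.
have [thy thyD [thyx thyy thyz]] := D_ex 0 1 0.
have [thx thxD [thxx thxy thxz]] := D_ex 1 0 0.
have [thz thzD [thzx thzy thzz]] := D_ex 0 0 w.
pose psi := prod_cochain [:: thy; thx; thz].
have psic : is_cochain 3 psi.
  have [thyl _] := thyD; have [thxl _] := thxD; have [thzl _] := thzD.
  have thy1 := twisted_der1 epsH epsH thyD; have thx1 := twisted_der1 epsH epsH thxD.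
  have thz1 := twisted_der1 epsH epsH thzD.
  by apply: (@prod_cochainP [:: thy; thx; thz]) => [[|[|[|[|i]]]]|[|[|[|i]]]].
have thyu : thy u = 1.
  by case: thyD => tl _; have := tl 1 x y; rewrite !scale1r thyx thyy add0r.
suff /hcoboundaryP[h hc E] : f - hdiff 3 psi \in hcoboundary 4.
  apply/hcoboundaryP; exists (1 *: psi + h); first exact: cochain_lin.
  by rewrite hdiff_lin scale1r -E addrC subrK.
have /hcocycleP[gc g0] : f - hdiff 3 psi \in hcocycle 4.
  by rewrite rpredB // hdiff_cocycle.
apply/hcoboundaryP; apply: cocycle4_coboundary => //.
  by case: (gc) => gn _ _; rewrite -(hdiffE gn).
rewrite -[LHS]/(f _ - hdiff 3 psi _) fw hdiff3_koszul // /psi /= thyu thxx thzz.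
by rewrite thyx !mul0r mulr0 add0r !mul1r mulr1 subrr.
Qed.

Lemma u_yn_x n : u * (y ^+ n * x) = 0.
Proof.
elim: n => [|n IH]; first by rewrite expr0 mul1r.
(* One y is replaced by u - x; the x-part dies by ux = 0 and the u-part by induction. *)
have -> : u * (y ^+ n.+1 * x) = u * (u - x) * (y ^+ n * x).
  by rewrite [u - x]addrC addrA addNr add0r exprS !mulrA.
by rewrite mulrBr mulrBl ux0 mul0r subr0 -mulrA IH mulr0.
Qed.

Lemma z_yn n : z * y ^+ n.+1 = 0.
Proof. by rewrite exprS mulrA zy0 mul0r. Qed.

Lemma x_zn n : x * z ^+ n.+1 = 0.
Proof. by rewrite exprS mulrA xz0 mul0r. Qed.

Lemma zn_y n : z ^+ n.+1 * y = 0.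
Proof. by rewrite exprSr -mulrA zy0 mulr0. Qed.

Lemma cocycle_of_derivation dx dy dz :
  u * dx + (dx + dy) * x = 0 -> x * dz + dx * z = 0 -> z * dy + dz * y = 0 ->
  exists2 f, f \in hcocycle 1 & [/\ f [:: x] = dx, f [:: y] = dy & f [:: z] = dz].
Proof.
move=> rux rxz rzy.
have [D DD [Dx Dy Dz]] := twisted_der_exists alg_hom_id alg_hom_id rux rxz rzy.
exists (prod_cochain [:: D]); first exact: derivation_hcocycle.
by rewrite /= !mulr1.
Qed.

Lemma cocycleL_exists n : exists2 f, f \in hcocycle 1 &
  [/\ f [:: x] = y ^+ n * x, f [:: y] = y ^+ n.+1 & f [:: z] = 0].
Proof.
apply: cocycle_of_derivation.
- by rewrite u_yn_x add0r exprSr -mulrDr -mulrA ux0 mulr0.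
- by rewrite mulr0 add0r -mulrA xz0 mulr0.
- by rewrite z_yn mul0r addr0.
Qed.

Lemma cocycleH_exists n : exists2 f, f \in hcocycle 1 &
  [/\ f [:: x] = 0, f [:: y] = 0 & f [:: z] = z ^+ n.+1].
Proof.
apply: cocycle_of_derivation; first by rewrite mulr0 addr0 mul0r addr0.
- by rewrite x_zn mul0r addr0.
- by rewrite mulr0 zn_y addr0.
Qed.

(* The 4-cocycle is a cup product of four 1-cocycles with coefficients, the first and
   the last ones being one-sided; its value on uxzy is y^(n+1) . 1 . 1 . x. *)
Lemma cocycleI_exists n : exists2 f, f \in hcocycle 4 &
  forall a b, [/\ f [:: a * u; x; z; y] = a * (y ^+ n.+1 * x),
    f [:: u; x; z; y * b] = y ^+ n.+1 * x * b,
    f [:: u; y * a * x; z; y] = 0 & f [:: u; x; 0; y] = 0].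
Proof.
have [eps epsH [epsx epsy epsz]] := augmentation_exists.
have [el e1 eM] := epsH.
have epsu : eps u = 0 by have := el 1 x y; rewrite !scale1r epsx epsy addr0.
(* The relation zy requires z * y^(n+1) = 0, hence a positive exponent. *)
have [|||la laD [lax lay laz]] := @twisted_der_exists A id eps 0 (y ^+ n.+1) 0 alg_hom_id epsH.
- by rewrite epsx !mulr0 addr0.
- by rewrite mulr0 mul0r addr0.
- by rewrite z_yn mul0r addr0.
(* The value -x at x makes [rho] vanish on u, as the relation ux demands. *)
have [|||rho rhoD [rhox rhoy rhoz]] := @twisted_der_exists A eps id (- x) x 0 epsH alg_hom_id.
- by rewrite epsu mul0r addNr mul0r addr0.
- by rewrite epsx mul0r mulNr xz0 oppr0 addr0.
- by rewrite epsz !mul0r addr0.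
have [|||mu muD [mux muy muz]] := @twisted_der_exists A eps eps 1 0 0 epsH epsH.
- by rewrite epsu epsx mul0r mulr0 addr0.
- by rewrite epsx epsz mul0r mulr0 addr0.
- by rewrite mulr0 mul0r addr0.
have [|||nu nuD [nux nuy nuz]] := @twisted_der_exists A eps eps 0 0 1 epsH epsH.
- by rewrite epsx !mulr0 addr0.
- by rewrite epsx mul0r mul0r addr0.
- by rewrite mulr0 epsy mulr0 addr0.
exists (prod_cochain [:: la; mu; nu; rho]); first exact: (prod4_hcocycle epsH).
have lau : la u = y ^+ n.+1.
  by case: laD => ll _; have := ll 1 x y; rewrite !scale1r lax lay add0r.
have nu0 : nu 0 = 0.
  by case: nuD => nl _; have := nl (-1) 0 0; rewrite scaler0 addr0 scaleN1r addNr.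
case: laD muD rhoD => _ laM [_ muM] [_ rhoM].
move=> a b; rewrite /= laM rhoM !muM eM lau mux nuz rhoy epsu epsy epsx nu0.
split.
- by rewrite mulr0 addr0 !mulr1 !mul1r mulrA.
- by rewrite mul0r add0r mulr1 !mul1r mulrA.
- by rewrite muy !mul0r !mulr0 !addr0 !mul0r mulr0.
- by rewrite mul0r !mulr0.
Qed.

(** * Brackets of the explicit cocycles *)

Definition cocycleL n f := f \in hcocycle 1 /\
  [/\ f [:: x] = y ^+ n * x, f [:: y] = y ^+ n.+1 & f [:: z] = 0].

Definition cocycleH n f := f \in hcocycle 1 /\
  [/\ f [:: x] = 0, f [:: y] = 0 & f [:: z] = z ^+ n.+1].

(** The index is shifted: this represents A^{-4}(n+1). Beyond the value on u, x, z, y, the clauses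
    cover the arguments that arise when L_j with j >= 1 is substituted into one entry: it sends u to
    y^j u, x to y^j x, z to 0 and y to y^(j+1). *)
Definition cocycleI n f := f \in hcocycle 4 /\
  forall a b, [/\ f [:: a * u; x; z; y] = a * (y ^+ n.+1 * x),
    f [:: u; x; z; y * b] = y ^+ n.+1 * x * b,
    f [:: u; y * a * x; z; y] = 0 & f [:: u; x; 0; y] = 0].

Lemma derivation_expr f v n m : f \in hcocycle 1 -> f [:: v] = v ^+ n.+1 ->
  f [:: v ^+ m] = v ^+ (m + n) *+ m.
Proof.
move=> /hcocycleP[fc f0] fv; have [fl fM] := cocycle1_derivation fc f0.
elim: m => [|m IH]; first by rewrite expr0 mulr0n; have [_ _ f1] := fc; apply: (f1 [::] [::]).
rewrite exprS fM IH fv -exprD mulrnAr -exprS [in RHS]mulrS addSn.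
by rewrite [(n + m)%N]addnC.
Qed.

Lemma hh_bracket_derivation f g h (c : k) : f \in hcocycle 1 -> g \in hcocycle 1 ->
  h \in hcocycle 1 ->
  (forall v, v \in [:: x; y; z] -> f [:: g [:: v]] - g [:: f [:: v]] = c *: h [:: v]) ->
  hh_bracket (hh_class 1 f) (hh_class 1 g) = c *: hh_class 1 h :> HH A 1.
Proof.
move=> fc gc hc E; rewrite (hh_bracket_class fc gc) -hh_classZ //.
have lc := lie_cocycle fc gc; have chc : c *: h \in hcocycle 1 by apply: rpredZ.
apply/hh_class_eq => //.
have Ev v : v \in [:: x; y; z] -> (lie (fun b => f [:: b]) g - c *: h) [:: v] = 0.
  by move=> /E vE; rewrite -[LHS]/(f _ - (g _ + 0) - c *: h _) addr0 vE subrr.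
apply: hcocycle1_coboundary; first exact: rpredB.
- by apply: Ev; rewrite !inE eqxx.
- by apply: Ev; rewrite !inE eqxx orbT.
- by apply: Ev; rewrite !inE eqxx !orbT.
Qed.

Lemma hh_bracketL n m f g h : cocycleL n f -> cocycleL m g -> cocycleL (m + n) h ->
  hh_bracket (hh_class 1 f) (hh_class 1 g) = (m%:R - n%:R) *: hh_class 1 h :> HH A 1.
Proof.
move=> [fc [fx fy fz]] [gc [gx gy gz]] [hc [hx hy hz]].
apply: hh_bracket_derivation => // v.
have derM e a b : e \in hcocycle 1 -> e [:: a * b] = e [:: a] * b + a * e [:: b].
  by move=> /hcocycleP[ec e0]; case: (cocycle1_derivation ec e0).
have der0 e : e \in hcocycle 1 -> e [:: 0] = 0.
  by move=> /hcocycleP[[_ el _] _]; apply: (mlin0 [::] [::] el).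
rewrite !inE => /or3P[]/eqP ->.
- rewrite gx fx hx !derM // (derivation_expr _ fc fy) (derivation_expr _ gc gy) fx gx.
  rewrite !mulrA -!exprD [(n + m)%N]addnC opprD addrACA subrr addr0.
  by rewrite !mulrnAl scalerBl !scaler_nat.
- rewrite gy fy hy (derivation_expr _ fc fy) (derivation_expr _ gc gy) -addSn.
  have -> : (n.+1 + m = m.+1 + n)%N by rewrite !addSn addnC.
  rewrite !mulrS opprD addrACA subrr add0r addSn.
  by rewrite scalerBl !scaler_nat.
- by rewrite gz fz hz !der0 // subrr scaler0.
Qed.

Lemma hh_bracketH n m f g h : cocycleH n f -> cocycleH m g -> cocycleH (m + n) h ->
  hh_bracket (hh_class 1 f) (hh_class 1 g) = (m%:R - n%:R) *: hh_class 1 h :> HH A 1.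
Proof.
move=> [fc [fx fy fz]] [gc [gx gy gz]] [hc [hx hy hz]].
apply: hh_bracket_derivation => // v.
have der0 e : e \in hcocycle 1 -> e [:: 0] = 0.
  by move=> /hcocycleP[[_ el _] _]; apply: (mlin0 [::] [::] el).
rewrite !inE => /or3P[]/eqP ->.
- by rewrite gx fx hx !der0 // subrr scaler0.
- by rewrite gy fy hy !der0 // subrr scaler0.
- rewrite gz fz hz (derivation_expr _ fc fz) (derivation_expr _ gc gz) -addSn.
  have -> : (n.+1 + m = m.+1 + n)%N by rewrite !addSn addnC.
  rewrite !mulrS opprD addrACA subrr add0r addSn.
  by rewrite scalerBl !scaler_nat.
Qed.

(** In f(y^(m+1) x) the contribution of f(x) cancels the substitution at u, and the substitutions at
    x and z vanish. The substitution at y leaves -y^(m+1) x y^(n+1), a coboundary. The positive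
    index of L is used twice: y^(n+1) x begins with y, and the leftover term ends with y. *)
Lemma hh_bracketLI n m f g h : cocycleL n.+1 f -> cocycleI m g -> cocycleI (m + n.+1) h ->
  hh_bracket (hh_class 1 f) (hh_class 4 g) = m.+1%:R *: hh_class 4 h :> HH A 4.
Proof.
move=> [fc [fx fy fz]] [gc gE] [hc hE].
rewrite (hh_bracket_class fc gc) -hh_classZ //.
have lc := lie_cocycle fc gc.
have chc : m.+1%:R *: h \in hcocycle 4 by apply: rpredZ.
apply/hh_class_eq => //.
apply: (@hcocycle4_coboundary _ (- (y ^+ m.+1 * x * y ^+ n))); first exact: rpredB.
have /hcocycleP[fcc f0] := fc; have [fl fM] := cocycle1_derivation fcc f0.
have fu : f [:: u] = y ^+ n.+1 * u.
  by have := fl 1 x y; rewrite !scale1r fx fy => ->; rewrite mulrDr -exprSr.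
have g1 : g [:: u; x; z; y] = y ^+ m.+1 * x.
  by have [] := gE 1 1; rewrite !mul1r.
have h1 : h [:: u; x; z; y] = y ^+ (m.+1 + n.+1) * x.
  by have [] := hE 1 1; rewrite !mul1r.
rewrite -[LHS]/(f [:: g [:: u; x; z; y]] - (g [:: f [:: u]; x; z; y] +
  (g [:: u; f [:: x]; z; y] + (g [:: u; x; f [:: z]; y] + (g [:: u; x; z; f [:: y]] + 0))))
  - m.+1%:R *: h [:: u; x; z; y]).
have [gu _ _ _] := gE (y ^+ n.+1) 1; have [_ _ gx gz] := gE (y ^+ n) 1.
have [_ gy _ _] := gE 1 (y ^+ n.+1).
rewrite -exprS in gx; rewrite -exprS in gy.
rewrite g1 h1 fu fx fy fz gu gx gz gy.
rewrite fM (derivation_expr _ fc fy) fx !add0r addr0 scaler_nat -mulrnAl.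
rewrite !mulrA -!exprD [(n.+1 + m.+1)%N]addnC mulNr.
rewrite -[y ^+ m.+1 * x * y ^+ n * y]mulrA -exprSr opprD !addrA addrK.
by rewrite addrAC subrr add0r.
Qed.

(** T after evaluation at v turns the cocycles into distinct monomials of positive degree and
    coboundaries into constants, so each coefficient of a linear relation can be read off. *)
Lemma free_hh_class n s d (e : nat -> seq A -> A) v (T : A -> {poly k}) :
  linear T -> (forall i, (s <= i)%N -> e i \in hcocycle n.+1) ->
  (forall i, (s <= i)%N -> T (e i v) = 'X^(i + d)) -> (0 < s + d)%N ->
  (forall h, is_cochain n h -> (size (T (hdiff n h v)) <= 1)%N) ->
  free_from s (fun i => hh_class n.+1 (e i)).
Proof.
move=> Tl ec Te sd Th N c.
have T0 : T 0 = 0 by have := Tl (-1) 0 0; rewrite scaler0 addr0 scaleN1r addNr.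
(* F is one cocycle that represents the whole combination, so that a relation between classes makes
   F itself a coboundary. *)
have [F [Fc FE FT]] : exists F, [/\ F \in hcocycle n.+1,
    hh_class n.+1 F = \sum_(s <= i < N) c i *: hh_class n.+1 (e i)
  & T (F v) = \sum_(s <= i < N) c i *: 'X^(i + d)].
  elim: N => [|N [F [Fc FE FT]]].
    by exists 0; rewrite rpred0 hh_class0 !big_geq // T0.
  have [sN|Ns] := leqP s N; last by exists 0; rewrite rpred0 hh_class0 !big_geq // T0.
  have cec : c N *: e N \in hcocycle n.+1 by apply/rpredZ/ec.
  exists (c N *: e N + F); rewrite !big_nat_recr //= hh_classD // hh_classZ ?ec // FE addrC.
  split=> //; first exact: rpredD.
  by rewrite -[(_ + F) v]/(c N *: e N v + F v) Tl Te // FT addrC.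
rewrite -FE -(hh_class0 A n.+1) => /(hh_class_eq Fc (rpred0 _)); rewrite subr0.
move=> /hcoboundaryP[h /Th hT FE'] i /andP[si iN].
have : (T (F v))`_(i + d) = 0.
  by rewrite FE' nth_default // (leq_trans hT) // (leq_trans sd) // leq_add2r.
rewrite FT coef_sum (big_nat_widenl _ 0) // big_mkord (bigD1 (Ordinal iN)) //=.
rewrite coefZ coefXn eqxx mulr1 big1 ?addr0 // => j /andP[_ ji].
rewrite coefZ coefXn eqn_add2r; case: eqP => [ij|_]; last by rewrite mulr0.
by case/eqP: ji; apply/val_inj.
Qed.

Lemma hdiff0_seq1 h v : is_cochain 0 h -> hdiff 0 h [:: v] = v * h [::] - h [::] * v.
Proof. by move=> [hn _ _]; rewrite hdiffE // hdif_cons bar_tailE. Qed.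

Lemma alg_hom_expr (B : algType k) (h : A -> B) a n : alg_hom h -> h (a ^+ n) = h a ^+ n.
Proof.
by move=> [_ h1 hM]; elim: n => [|n IH]; rewrite ?expr0 // !exprS hM IH.
Qed.

(** The target of p is commutative, so p kills the commutators, which are the values of the inner
    derivations. *)
Lemma free_derivations s (e : nat -> seq A -> A) v (p : A -> {poly k}) :
  alg_hom p -> p v = 'X -> (forall i, e i \in hcocycle 1) ->
  (forall i, e i [:: v] = v ^+ i.+1) -> free_from s (fun i => hh_class 1 (e i)).
Proof.
move=> ph pv ec ev; have [pl _ pM] := ph.
apply: (@free_hh_class 0 s 1 e [:: v] p) => // [i _||h hc].
- by rewrite ev alg_hom_expr // pv addn1.
- by rewrite addn1.
rewrite hdiff0_seq1 //.
have -> : p (v * h [::] - h [::] * v) = 0.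
  have := pl (-1) (h [::] * v) (v * h [::]); rewrite !scaleN1r [- _ + v * _]addrC => ->.
  by rewrite !pM mulrC addNr.
by rewrite size_poly0.
Qed.

Lemma free_cocycleL s e : (forall n, cocycleL n (e n)) -> free_from s (fun i => hh_class 1 (e i)).
Proof.
move=> eL; have [|||p ph [_ py _]] := @alg_hom_exists {poly k} 0 'X 0; rewrite ?mulr0 ?mul0r //.
by apply: (free_derivations ph py) => i; case: (eL i) => // _ [].
Qed.

Lemma free_cocycleH s e : (forall n, cocycleH n (e n)) -> free_from s (fun i => hh_class 1 (e i)).
Proof.
move=> eL; have [|||p ph [_ _ pz]] := @alg_hom_exists {poly k} 0 0 'X; rewrite ?mulr0 ?mul0r //.
by apply: (free_derivations ph pz) => i; case: (eL i) => // _ [].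
Qed.

(** The functional T is a derivation twisted by [chi] on the left, with chi(u) = 0 and chi(y) = X,
    and by the augmentation on the right. It sends u a + b y to the augmentation of a, a constant,
    and y^n x to X^n; starting at n = 1 keeps the monomials away from the constants. *)
Lemma free_cocycleI e : (forall n, cocycleI n (e n.+1)) -> free_from 1 (fun i => hh_class 4 (e i)).
Proof.
move=> eI.
have [|||chi chiH [chix chiy chiz]] := @alg_hom_exists {poly k} (- 'X) 'X 0.
- by rewrite addNr mul0r.
- by rewrite mulr0.
- by rewrite mul0r.
have [|||eps epsH [epsx epsy epsz]] := @alg_hom_exists {poly k} 0 0 0; rewrite ?mulr0 //.
have chiu : chi u = 0.
  by have [cl _ _] := chiH; have := cl 1 x y; rewrite !scale1r chix chiy addNr.
have [|||T [Tl TM] [Tx Ty Tz]] := @twisted_der_exists {poly k} chi eps 1 0 0 chiH epsH.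
- by rewrite chiu mul0r epsx mulr0 addr0.
- by rewrite mulr0 epsz mulr0 addr0.
- by rewrite mulr0 mul0r addr0.
have Tu : T u = 1 by have := Tl 1 x y; rewrite !scale1r Tx Ty addr0.
apply: (@free_hh_class 3 1 0 e [:: u; x; z; y] T) => //.
- by move=> [//|i] _; case: (eI i).
- move=> [//|i] _; case: (eI i) => _ /(_ 1 1) [].
  by rewrite !mul1r => -> _ _ _; rewrite TM Tx epsx mulr0 addr0 mulr1 alg_hom_expr // chiy addn0.
move=> h hc; rewrite hdiff3_koszul //.
have -> : T (u * h [:: x; z; y] + h [:: u; x; z] * y) = eps (h [:: x; z; y]).
  have := Tl 1 (u * h [:: x; z; y]) (h [:: u; x; z] * y); rewrite !scale1r => ->.
  by rewrite !TM chiu Tu Ty epsy mul0r !mulr0 !addr0 add0r mul1r.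
move: (h _); have [el e1 eM] := epsH.
apply: A_ind => [c a b Ha Hb||a Ha|a Ha|a Ha]; rewrite ?el ?e1 ?eM ?epsx ?epsy ?epsz ?mulr0
  ?size_poly0 ?size_poly1 //.
by apply: (leq_trans (size_polyD _ _)); rewrite geq_max Hb (leq_trans (size_scale_leq _ _)).
Qed.

(** The bracket of two classes of degree 4 lies in degree 4 + 4 - 1 = 7. *)
Lemma HH7_eq0 (c : HH A 7) : c = 0.
Proof.
rewrite -[LHS]hh_class_repr -(hh_class0 A 7).
apply/(hh_class_eq (hh_repr_cocycle c) (rpred0 _)); rewrite subr0.
exact/hcocycle7_coboundary/hh_repr_cocycle.
Qed.

Lemma eq_free_from (V : lmodType k) s (e e' : nat -> V) :
  (forall n, (s <= n)%N -> e n = e' n) -> free_from s e -> free_from s e'.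
Proof.
move=> ee' fe N c; rewrite -(@eq_big_nat _ _ _ s N (fun n => c n *: e n)); first exact: fe.
by move=> n /andP[sn _]; rewrite ee'.
Qed.

Lemma witt_structure (L L' : nat -> HH A 1) (I : nat -> HH A 4) fL fH fI :
  (forall n, cocycleL n (fL n)) -> (forall n, cocycleH n (fH n)) ->
  (forall n, cocycleI n (fI n)) -> (forall n, L n = hh_class 1 (fL n)) ->
  (forall n, L' n.+1 = hh_class 1 (fH n)) -> (forall n, I n.+1 = hh_class 4 (fI n)) ->
  [/\ witt_part 0 L, witt_part 0 (fun n => L' n.+1) & W00_positive_part L I].
Proof.
move=> fLP fHP fIP LE L'E IE.
have Lw s : witt_part s L.
  split=> [|n m _ _].
    by have := @free_cocycleL s _ fLP; apply: eq_free_from => n _; rewrite LE.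
  by rewrite !LE; apply: hh_bracketL.
have LI n m : (1 <= n)%N -> (1 <= m)%N -> hh_bracket (L n) (I m) = m%:R *: I (m + n)%N.
  by case: n m => [|n] [|m] // _ _; rewrite LE IE [I _]IE; apply: hh_bracketLI.
split=> //.
  split=> [|n m _ _].
    by have := @free_cocycleH 0 _ fHP; apply: eq_free_from => n _; rewrite L'E.
  by rewrite !L'E; apply: hh_bracketH.
split=> //.
- have := @free_cocycleI (fun n => fI n.-1) fIP.
  by apply: eq_free_from => -[//|n] _; rewrite IE.
- by move=> n m n1 m1; rewrite -LI //; apply: hh_bracketC.
- by move=> n m _ _; apply: HH7_eq0.
Qed.
End KoszulContraction.

(** * The Koszul classes of A *)

Lemma mem_seq3 (T : eqType) (a b c : T) :
  [/\ a \in [:: a; b; c], b \in [:: a; b; c] & c \in [:: a; b; c]].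
Proof. by split; rewrite !inE eqxx ?orbT. Qed.

Section KoszulClasses.
Variable k : fieldType.
Local Notation A := (algA k).
Local Notation x := (Ax k).
Local Notation y := (Ay k).
Local Notation z := (Az k).
Implicit Types f g h : seq A -> A.

Lemma algA_map (N : lmodType k) (Rx Ry Rz : N -> N) (n0 : N) :
  linear Rx -> linear Ry -> linear Rz ->
  (forall n, Rx (Rx n) + Rx (Ry n) = 0) -> (forall n, Rz (Rx n) = 0) ->
  (forall n, Ry (Rz n) = 0) ->
  {T : A -> N | [/\ linear T, T 1 = n0, forall a, T (a * x) = Rx (T a),
    forall a, T (a * y) = Ry (T a) & forall a, T (a * z) = Rz (T a)]}.
Proof.
move=> xl yl zl rxx rxz rzy; exists (rmod_map Rx Ry Rz n0).
exact: rmod_mapP.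
Qed.

(** [xget] is pinned down by uniqueness. The class of f qualifies because the coboundary between f
    and the chosen representative restricts to a Koszul coboundary; any other candidate agrees with
    f on the Koszul tensors after such a correction, and is then equal to it by the injectivity
    assumption. *)
Lemma koszul_classE n f : f \in hcocycle n.+1 ->
  (forall h v, is_cochain n h -> v \in koszul_basis k n.+1 -> hdiff n h v = koszul_diff h v) ->
  (forall g, g \in hcocycle n.+1 -> (forall v, v \in koszul_basis k n.+1 -> g v = 0) ->
     g \in hcoboundary n.+1) ->
  koszul_class n.+1 [seq f v | v <- koszul_basis k n.+1] = hh_class n.+1 f.
Proof.
move=> fc dE inj; apply: xget_unique => [|c [psi psic /eq_in_map E]] /=.
  have [h hc hE] := hh_repr_class fc; exists h => //.
  by apply/eq_in_map => v vB; rewrite hE -(dE h v hc vB) -[LHS]/(f v + hdiff n h v - _) addrK.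
rewrite -[LHS]hh_class_repr; apply/(hh_class_eq (hh_repr_cocycle c) fc).
apply: (cohomologous_on inj (hh_repr_cocycle c) fc psic) => v vB.
by rewrite (dE psi) //; apply: E.
Qed.

Lemma koszul_class1 f : f \in hcocycle 1 ->
  koszul_class 1 [:: f [:: x]; f [:: y]; f [:: z]] = hh_class 1 f.
Proof.
move=> fc; apply: (koszul_classE fc) => [h v hc|g gc g0].
  have E w : hdiff 0 h [:: w] = koszul_diff h [:: w].
    by rewrite hdiff0_seq1 // /koszul_diff /= expr1 mulN1r.
  by rewrite !inE => /or3P[]/eqP ->; apply: E.
have [mx my mz] := mem_seq3 [:: x] [:: y] [:: z].
by apply: (hcocycle1_coboundary (@algA_ind k) gc); apply: g0; [exact: mx|exact: my|exact: mz].
Qed.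

Lemma koszul_class4 f : f \in hcocycle 4 ->
  koszul_class 4 [:: f [:: x + y; x; z; y]] = hh_class 4 f.
Proof.
move=> fc; apply: (koszul_classE fc) => [h v hc|g gc g0].
  rewrite inE => /eqP ->.
  apply: (etrans (hdiff3_koszul (ux0 k) (xz0 k) (zy0 k) hc)).
  rewrite /koszul_diff.
  have E4 : (-1) ^+ 4 = 1 :> A by rewrite -signr_odd expr0.
  rewrite [size _]/=.
  rewrite E4 mul1r.
  reflexivity.
apply: (@hcocycle4_coboundary k A x y z (ux0 k) (xz0 k) (zy0 k) (@algA_ind k) algA_map g 0 gc).
by rewrite mul0r; apply: g0; exact: mem_head.
Qed.

Lemma cocycle_families : exists fL fH fI : nat -> seq A -> A,
  [/\ forall n, cocycleL x y z n (fL n), forall n, cocycleH x y z n (fH n)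
    & forall n, cocycleI x y z n (fI n)].
Proof.
have [fL LP] : {fL : nat -> seq A -> A & forall n, cocycleL x y z n (fL n)}.
  apply: choice => n.
  by have [f fc fE] := cocycleL_exists (ux0 k) (xz0 k) (zy0 k) (@algA_ind k) (@algA_map) n; exists f.
have [fH HP] : {fH : nat -> seq A -> A & forall n, cocycleH x y z n (fH n)}.
  apply: choice => n.
  by have [f fc fE] := cocycleH_exists (ux0 k) (xz0 k) (zy0 k) (@algA_ind k) (@algA_map) n; exists f.
have [fI IP] : {fI : nat -> seq A -> A & forall n, cocycleI x y z n (fI n)}.
  apply: choice => n.
  by have [f fc fE] := cocycleI_exists (ux0 k) (xz0 k) (zy0 k) (@algA_ind k) (@algA_map) n; exists f.
by exists fL, fH, fI.
Qed.

Lemma clsB1E n f : cocycleL x y z n f -> clsB1 k n = hh_class 1 f.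
Proof. by move=> [fc [fx fy fz]]; rewrite -(koszul_class1 fc) fx fy fz. Qed.

Lemma clsA1E f : cocycleL x y z 0 f -> clsA1 k = hh_class 1 f.
Proof. by move=> [fc [fx fy fz]]; rewrite -(koszul_class1 fc) fx fy fz expr0 mul1r expr1. Qed.

Lemma clsH1E n f : cocycleH x y z n f -> clsH1 k n.+1 = hh_class 1 f.
Proof. by move=> [fc [fx fy fz]]; rewrite -(koszul_class1 fc) fx fy fz. Qed.

Lemma clsA4E n f : cocycleI x y z n f -> clsA4 k n.+1 = hh_class 4 f.
Proof.
move=> [fc fE]; rewrite -(koszul_class4 fc).
by have [] := fE 1 1; rewrite !mul1r => -> _ _ _.
Qed.

End KoszulClasses.

(* In (ii) the family {L'_n}_{n >= 1} is indexed as (L'_{n+1})_{n >= 0}: the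
   derivation z |-> z^{n+1} has Witt index n. *)
Theorem corollary5p9 (k : fieldType) (char0 : [pchar k] =i pred0) :
  let L (n : nat) : HH (algA k) 1 := if n is 0 then clsA1 k else clsB1 k n in
  let L' (n : nat) : HH (algA k) 1 := clsH1 k n in
  let I (n : nat) : HH (algA k) 4 := clsA4 k n in
  [/\ witt_part 0 L,
      witt_part 0 (fun n => L' n.+1)
    & W00_positive_part L I].
Proof.
move=> L L' I; have [fL [fH [fI [fLP fHP fIP]]]] := cocycle_families k.
have LE n : L n = hh_class 1 (fL n).
  by case: n => [|n]; [apply: clsA1E|apply: clsB1E].
have L'E n : L' n.+1 = hh_class 1 (fH n) by apply: clsH1E.
have IE n : I n.+1 = hh_class 4 (fI n) by apply: clsA4E.
clearbody L L' I.
exact: (witt_structure (ux0 k) (xz0 k) (zy0 k) (@algA_ind k) (@algA_map k) fLP fHP fIP LE L'E IE).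
Qed.
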